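(* For every integer $n\ge 3$, the maximum number of triangles in an $n$-vertex $W_{\ge 4}$-free graph satisfies \[ \mathrm{ex}(n,K_3,W_{\ge 4})=h(n). \] Moreover, $H(n)$ is the unique extremal graph: if $G$ is an $n$-vertex $W_{\ge 4}$-free graph with exactly $h(n)$ triangles, then $G\cong H(n)$ (and $H(n)$ itself is an $n$-vertex $W_{\ge 4}$-free graph with $h(n)$ triangles).
   Context: All graphs are finite and simple. For a family $\mathcal F$ of graphs, a graph is $\mathcal F$-free if it contains no member of $\mathcal F$ as a (not necessarily induced) subgraph. The wheel $W_\ell$ ($\ell\ge 3$) is the graph on $\ell+1$ vertices obtained by joining a new vertex to all vertices of a cycle of length $\ell$; $W_{\ge 4}=\{W_\ell:\ell\ge 4\}$. The number $\mathrm{ex}(n,K_3,\mathcal F)$ is the maximum number of copies of $K_3$ (triangles) in an $n$-vertex $\mathcal F$-free graph, and an $n$-vertex $\mathcal F$-free graph attaining this maximum is called an extremal graph. The function $h$ is defined by \[ h(n)=\begin{cases} n^2/4, & n\equiv 0 \pmod 4,\\ n^2/4-1, & n\equiv 2\pmod 4,\\ \lfloor (n^2-n)/4\rfloor, & n\equiv 1,3\pmod 4.\end{cases} \] For positive integers $a,b$, $H_{a,b}$ is the graph obtained from the complete bipartite graph $K_{a,b}$ by adding a maximum matching inside each part (i.e. $\lfloor a/2\rfloor$ pairwise disjoint edges inside the part of size $a$ and $\lfloor b/2\rfloor$ pairwise disjoint edges inside the part of size $b$). For $n\le 4$, $H(n)=K_n$. For $n\ge 5$, \[ H(n)=\begin{cases}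 H_{2m,2m}, & n=4m,\\ H_{2m,2m+1}, & n=4m+1,\\ H_{2m,2m+2}, & n=4m+2,\\ H_{2m+1,2m+2}, & n=4m+3.\end{cases} \] *)

(* Defs.v *)
From mathcomp Require Import all_boot.
From mathcomp Require Import boolp.

Set Implicit Arguments.
Unset Strict Implicit.
Unset Printing Implicit Defensive.

Record sgraph := SGraph {
  vertex :> finType;
  adj : rel vertex;
  adj_sym : symmetric adj;
  adj_irr : irreflexive adj }.

Section OfRel.
Variables (V : finType) (r : rel V).

Definition simple_closure : rel V :=
  [rel x y | (x != y) && (r x y || r y x)].

Lemma simple_closure_sym : symmetric simple_closure.
Proof. by move=> x y; rewrite /simple_closure /= eq_sym orbC. Qed.

Lemma simple_closure_irr : irreflexive simple_closure.
Proof. by move=> x; rewrite /simple_closure /= eqxx. Qed.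

Definition of_rel : sgraph := SGraph simple_closure_sym simple_closure_irr.
End OfRel.

Definition contains (G F : sgraph) : Prop :=
  exists f : F -> G, injective f /\ forall x y, adj x y -> adj (f x) (f y).

Definition isomorphic (G F : sgraph) : Prop :=
  exists f : G -> F, bijective f /\ forall x y, adj (f x) (f y) = adj x y.

Definition is_free (F : sgraph -> Prop) (G : sgraph) : Prop :=
  forall A, F A -> ~ contains G A.

Definition triangles (G : sgraph) : {set {set G}} :=
  [set T : {set G} | (#|T| == 3)
     && [forall x in T, forall y in T, (x != y) ==> adj x y]].

(* Every graph with vertex set 'I_n has the same adjacency as some
   [of_rel E]. *)
Definition ex_K3 (n : nat) (F : sgraph -> Prop) : nat :=
  \max_(E : {set 'I_n * 'I_n}
        | `[< is_free F (of_rel (fun x y => (x, y) \in E)) >])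
     #|triangles (of_rel (fun x y => (x, y) \in E))|.

Definition complete (n : nat) : sgraph := of_rel (fun _ _ : 'I_n => true).

(* [ordS] is the successor modulo l; this is the l-cycle only for 3 <= l. *)
Definition cycle_graph (l : nat) : sgraph :=
  of_rel (fun i j : 'I_l => j == ordS i).

Definition cone (G : sgraph) : sgraph :=
  of_rel (fun x y : option G =>
    match x, y with
    | Some u, Some v => adj u v
    | None, Some _ => true
    | _, None => false
    end).

Definition wheel (l : nat) : sgraph := cone (cycle_graph l).

Definition wheels_ge4 (G : sgraph) : Prop :=
  exists2 l, 4 <= l & isomorphic G (wheel l).

Definition h (n : nat) : nat :=
  match n %% 4 with
  | 0 => n ^ 2 %/ 4
  | 2 => n ^ 2 %/ 4 - 1
  | _ => (n ^ 2 - n) %/ 4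
  end.

(* The matching inside each part is {0,1}, {2,3}, ...; the last vertex of a
   part of odd size is left unmatched. *)
Definition H2 (a b : nat) : sgraph :=
  of_rel (fun x y : 'I_a + 'I_b =>
    match x, y with
    | inl i, inl j => i./2 == j./2
    | inr i, inr j => i./2 == j./2
    | _, _ => true
    end).

Definition H (n : nat) : sgraph :=
  if n <= 4 then complete n else
  let m := n %/ 4 in
  match n %% 4 with
  | 0 => H2 (2 * m) (2 * m)
  | 1 => H2 (2 * m) (2 * m + 1)
  | 2 => H2 (2 * m) (2 * m + 2)
  | _ => H2 (2 * m + 1) (2 * m + 2)
  end.

(* Main.v *)
(* In a wheel-free graph the link of a vertex has no cycle of length at least 4,
   so a link on d vertices has at most 3(d-1)/2 edges. The bound on triangles is
   by induction on n, removing a clique K on four vertices. A vertex outside K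
   sees at most two vertices of K; two adjacent vertices that each see two of them
   see the same pair or complementary pairs, and those seeing a given pair induce
   a matching. Hence at most 2n - 4 triangles meet K, or 2n - 5 for n odd, which
   is h(n) - h(n-4). When this is tight, the rest of the graph is extremal, hence
   connected, and there is a pair P such that every vertex outside K sees P or
   K \ P: the graph splits into two parts of inner degree at most one, and among
   such graphs H(n) is the only maximum. If there is no K4, then links are
   forests, and the edge bound n^2/4 + n/2 (same induction; without K4, compare
   the forest bound on triangles with the bound of Nordhaus and Stewart) leaves at
   most n^2/6 triangles.
   Edges and triangles are counted as ordered pairs and triples. *)

Require Import Defs.
From mathcomp Require Import all_boot boolp zify.

Set Implicit Arguments.
Unset Strict Implicit.
Unset Printing Implicit Defensive.

(** * Ordered adjacent pairs, and graphs whose cycles are triangles *)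

Lemma sum_setU (T : finType) (A B : {set T}) (F : T -> nat) : [disjoint A & B] ->
  \sum_(x in A :|: B) F x = \sum_(x in A) F x + \sum_(x in B) F x.
Proof. by move=> dAB; rewrite -bigU //; apply: eq_bigl => x; rewrite !inE. Qed.

Lemma sum_card (T : finType) (A : {set T}) (P : pred T) :
  \sum_(x in A) (P x : nat) = #|[set x in A | P x]|.
Proof.
rewrite -sum1_card big_mkcond [RHS]big_mkcond; apply: eq_bigr => x _.
by rewrite inE; case: (x \in A); case: (P x).
Qed.

Section Arcs.
Variables (T : finType) (e : rel T).
Implicit Types (A B C D : {set T}) (x y z : T).

Definition arcs (A B : {set T}) : nat := \sum_(x in A) \sum_(y in B) e x y.

Definition nbhd (A : {set T}) (x : T) : {set T} := [set y in A | e x y].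

Lemma arcsE A B : arcs A B = \sum_(x in A) #|nbhd B x|.
Proof. by apply: eq_bigr => x _; rewrite sum_card. Qed.

Lemma arcs1l x B : arcs [set x] B = #|nbhd B x|.
Proof. by rewrite arcsE big_set1. Qed.

Lemma arcsUl A B C : [disjoint A & B] -> arcs (A :|: B) C = arcs A C + arcs B C.
Proof. exact: sum_setU. Qed.

Lemma arcsUr A B C : [disjoint B & C] -> arcs A (B :|: C) = arcs A B + arcs A C.
Proof.
by move=> d; rewrite /arcs -big_split; apply: eq_bigr => x _; rewrite sum_setU.
Qed.

Hypothesis e_sym : symmetric e.
Hypothesis e_irr : irreflexive e.

Lemma arcsC A B : arcs A B = arcs B A.
Proof. by rewrite /arcs exchange_big; apply: eq_bigr => x _; apply: eq_bigr => y _;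
  rewrite e_sym. Qed.

Lemma arcsUU A B : [disjoint A & B] ->
  arcs (A :|: B) (A :|: B) = arcs A A + arcs B B + 2 * arcs A B.
Proof. by move=> d; rewrite arcsUl // !arcsUr // (arcsC B A); lia. Qed.

Lemma arcs_set1 x : arcs [set x] [set x] = 0.
Proof. by rewrite /arcs !big_set1 e_irr. Qed.

Lemma arcs_even A : ~~ odd (arcs A A).
Proof.
have [n] := ubnP #|A|; elim: n A => // n IH A ltA.
have [->|[x xA]] := set_0Vmem A; first by rewrite /arcs big_set0.
rewrite -(setD1K xA) arcsUU ?disjoints1 ?inE ?eqxx // arcs_set1.
have := IH (A :\ x); rewrite (cardsD1 x A) xA in ltA.
by move=> /(_ _) IHA; rewrite add0n oddD mul2n odd_double addbF IHA //; lia.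
Qed.

(** Every block with an edge is a single edge or a triangle. [cycle] also accepts the two ends of an
    edge as a closed walk, which the bound 3 tolerates. *)
Definition cactus (D : {set T}) :=
  forall c, uniq c -> cycle e c -> {subset c <= D} -> size c <= 3.

Lemma cactusS D D' : D' \subset D -> cactus D -> cactus D'.
Proof. by move=> /subsetP sD cD c uc ec sc; apply: cD => // x /sc/sD. Qed.

(* The first vertex of a longest path has all its neighbours among the next two,
   and when it has both, the same applies to the path with its first two vertices
   swapped. *)
Lemma cactus_leaf D : cactus D -> D != set0 ->
  exists2 x, x \in D & #|nbhd D x| <= 1 \/
   exists y z, [/\ y \in D, z \in D & [/\ e x y, e y z & e x z]] /\
     (nbhd D x \subset [set y; z] /\ nbhd D y \subset [set x; z]).
Proof.
move=> cD /set0Pn[x0 x0D].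
pose P n := `[< exists x p, [/\ size p = n, path e x p, uniq (x :: p)
   & {subset x :: p <= D}] >].
have exP : exists n, P n.
  exists 0; apply/asboolP; exists x0, [::]; split=> // x; rewrite inE => /eqP-> //.
have ubP n : P n -> n <= #|T|.
  move=> /asboolP[x [p [<- _ /card_uniqP up _]]].
  by have := max_card [in x :: p]; rewrite up /=; lia.
case: (ex_maxnP exP ubP) => n /asboolP[x [p [sp ep up pD]]] maxn.
have first y q : size q = n -> path e y q -> uniq (y :: q) -> {subset y :: q <= D} ->
    nbhd D y \subset take 2 q.
  move=> sq eq uq qD; apply/subsetP => z; rewrite inE => /andP[zD yz].
  (* Otherwise prepending [z] would lengthen a longest path. *)
  have zq : z \in q.
    apply: contraT => zNq; suff /maxn : P n.+1 by lia.
    apply/asboolP; exists z, (y :: q); split.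
    - by rewrite /= sq.
    - by rewrite /= e_sym yz.
    - rewrite cons_uniq uq andbT inE negb_or zNq andbT.
      by apply: contraTneq yz => ->; rewrite e_irr.
    - by move=> t; rewrite inE => /orP[/eqP->|/qD].
  case: (leqP (index z q) 1) => [le1|lt1].
    have: z \in take 2 q; last by [].
    by rewrite in_take.
  (* Here [z] lies further along: the segment up to [z], closed by the edge back to [y], is a cycle
     with more than three vertices. *)
  have : size (y :: take (index z q).+1 q) <= 3.
    apply: cD.
    - by move: uq => /= /andP[yq uq]; rewrite take_uniq // andbT;
        apply: contra yq => /mem_take.
    - rewrite /= rcons_path take_path //=.
      have := index_mem z q; rewrite zq => lt.
      by rewrite (last_nth z) size_takel //= nth_take // nth_index // e_sym.
    - move=> t; rewrite inE => /orP[/eqP->|/mem_take tq]; first by apply: qD;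
        rewrite inE eqxx.
      by apply: qD; rewrite inE tq orbT.
  by rewrite /= size_takel ?index_mem //; lia.
exists x; first by apply: pD; rewrite inE eqxx.
have nx := first _ _ sp ep up pD.
case: p sp ep up pD nx => [|y [|z p]] sp ep up pD nx.
- by left; apply: leq_trans (subset_leq_card nx) (leq_trans (card_size _) _).
- by left; apply: leq_trans (subset_leq_card nx) (card_size _).
have nx2 : nbhd D x \subset [set y; z].
  by apply/subsetP => t /(subsetP nx); rewrite /= take0 !inE.
have [xz|xNz] := boolP (e x z); last first.
  left; rewrite -(cards1 y); apply/subset_leq_card/subsetP => t tx.
  have := subsetP nx2 t tx; rewrite !inE; case/orP => // /eqP tz.
  by move: tx; rewrite inE tz (negbTE xNz) andbF.
right; exists y, z; move: ep => /= /and3P[xy yz ep].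
split; first by split=> //; apply: pD; rewrite !inE eqxx ?orbT.
split=> //.
have : nbhd D y \subset take 2 (x :: z :: p).
  apply: first => //=; first by rewrite e_sym xy xz.
    by move: up; rewrite /= !inE !negb_or (eq_sym x y) -!andbA => /and5P[-> -> -> -> ->].
  by move=> t; rewrite !inE => Ht; apply: pD; rewrite !inE; move: Ht => /or3P[]->;
    rewrite ?orbT.
by move/subsetP => ny; apply/subsetP => t /ny; rewrite /= take0 !inE.
Qed.

Lemma arcsD1 D x : x \in D -> arcs D D = arcs (D :\ x) (D :\ x) + 2 * #|nbhd D x|.
Proof.
move=> xD; rewrite -[in LHS](setD1K xD) arcsUU ?disjoints1 ?inE ?eqxx //.
rewrite arcs_set1 add0n arcs1l; congr (_ + 2 * _).
by apply: eq_card => y; rewrite !inE; case: eqP => // ->; rewrite e_irr !andbF.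
Qed.

(** Each edge is two arcs, so [k = 3] gives at most 3(d-1)/2 edges and [k = 2] is the forest bound
    d-1. Induction on [cactus_leaf]: delete a vertex with at most one neighbour, or two vertices of
    a triangle that carry no further edges, which costs three edges. *)
Lemma cactus_arcs D (k : nat) : cactus D -> D != set0 ->
  k = 3 \/ k = 2 /\ (forall x y z, x \in D -> y \in D -> z \in D ->
     e x y -> e y z -> e x z -> False) ->
  arcs D D + k <= k * #|D|.
Proof.
have [n] := ubnP #|D|; elim: n D => // n IH D ltD cD D0 kP.
(* The factor [D' != set0] lets the induction hypothesis cover an empty remainder. *)
have {}IH D' : D' \subset D -> #|D'| < #|D| -> arcs D' D' + (D' != set0) * k <= k * #|D'|.
  move=> sD lD; have [->|D'0] := eqVneq D' set0; first by rewrite /arcs big_set0.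
  rewrite mul1n; apply: IH => //; [lia| exact: cactusS cD|].
  case: kP => [|[k2 kP]]; [by left|right; split=> // x y z xD yD zD].
  by apply: kP; apply: (subsetP sD).
have [x xD [d1|]] := cactus_leaf cD D0.
  rewrite (arcsD1 xD); have := cardsD1 x D; rewrite xD => cDx.
  have {IH} := IH (D :\ x) (subsetDl _ _); rewrite cDx => /(_ (leqnn _)).
  have k2 : 2 <= k by case: kP => [->|[->]].
  have [D'0|_] := eqVneq (D :\ x) set0.
    have -> : nbhd D x = set0.
      apply/setP => y; rewrite !inE; have /setP/(_ y) := D'0.
      by rewrite !inE; case: eqP => [->|_ /= ->]; rewrite ?e_irr ?andbF.
    by rewrite D'0 /arcs big_set0 !cards0; lia.
  by nia.
case=> y [z [[yD zD [xy yz xz]] [nx ny]]].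
have k3 : k = 3.
  by case: kP => // -[_ /(_ x y z)]; move/(_ xD yD zD xy yz xz).
subst k.
have yx : y != x by apply: contraTneq xy => ->; rewrite e_irr.
have zx : z != x by apply: contraTneq xz => ->; rewrite e_irr.
have zy : z != y by apply: contraTneq yz => ->; rewrite e_irr.
have yD' : y \in D :\ x by rewrite !inE yx.
rewrite (arcsD1 xD) (arcsD1 yD').
have cx := cardsD1 x D; have cy := cardsD1 y (D :\ x); rewrite xD in cx; rewrite yD' in cy.
have {IH} := IH (D :\ x :\ y).
rewrite (subset_trans (subsetDl _ _) (subsetDl _ _)) => /(_ isT) IH.
have {}IH := IH ltac:(lia).
have D'0 : (D :\ x :\ y) != set0 by apply/set0Pn; exists z; rewrite !inE zx zy zD.
rewrite D'0 mul1n in IH.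
have n1 : #|nbhd D x| <= 2.
  by apply: leq_trans (subset_leq_card nx) _; rewrite cards2; case: eqP.
have n2 : #|nbhd (D :\ x) y| <= 1.
  rewrite -(cards1 z); apply/subset_leq_card/subsetP => t.
  rewrite !inE => /andP[/andP[tx tD] yt].
  by have /(subsetP ny) : t \in nbhd D y; rewrite !inE ?tD ?yt // (negbTE tx).
by move: IH n1 n2 cx cy; clear; lia.
Qed.

End Arcs.

(** * Arithmetic of h *)

Lemma h_4m m : [/\ h (4 * m) = 4 * m ^ 2, h (4 * m + 1) = 4 * m ^ 2 + m,
  h (4 * m + 2) = 4 * m ^ 2 + 4 * m & h (4 * m + 3) = 4 * m ^ 2 + 5 * m + 1].
Proof.
have m4 r : r < 4 -> (4 * m + r) %% 4 = r by lia.
rewrite /h -{1}[4 * m]addn0 !m4 //.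
by split; rewrite -?mulnn; nia.
Qed.

Lemma mod4_cases n : exists m, [\/ n = 4 * m, n = 4 * m + 1, n = 4 * m + 2 | n = 4 * m + 3].
Proof.
exists (n %/ 4); have : n %% 4 < 4 by rewrite ltn_mod.
by case E : (n %% 4) => [|[|[|[|?]]]] // _;
  [apply: Or41|apply: Or42|apply: Or43|apply: Or44]; lia.
Qed.

(** The increment is the bound on triangles meeting a K4 that has [n] vertices outside: four inside
    it, and [2 * n], or one fewer for odd [n]. *)
Lemma h_add4 n : h (n + 4) = h n + 2 * n + 4 - odd n.
Proof.
have [m [] ->] := mod4_cases n; have [h0 h1 h2 h3] := h_4m m;
  have [g0 g1 g2 g3] := h_4m m.+1.
- have -> : 4 * m + 4 = 4 * m.+1 by lia. rewrite g0 h0 -!mulnn; nia.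
- have -> : 4 * m + 1 + 4 = 4 * m.+1 + 1 by lia. rewrite g1 h1 -!mulnn; nia.
- have -> : 4 * m + 2 + 4 = 4 * m.+1 + 2 by lia. rewrite g2 h2 -!mulnn; nia.
- have -> : 4 * m + 3 + 4 = 4 * m.+1 + 3 by lia. rewrite g3 h3 -!mulnn; nia.
Qed.

Lemma h_lt n : 2 < n -> h n.-1 < h n.
Proof.
have [m [] ->] := mod4_cases n; have [h0 h1 h2 h3] := h_4m m => n2.
- case: m h0 h1 h2 h3 n2 => // m h0 _ _ _ _; have [_ _ _ g3] := h_4m m.
  have -> : (4 * m.+1).-1 = 4 * m + 3 by lia.
  by rewrite h0 g3 -!mulnn; nia.
- have -> : (4 * m + 1).-1 = 4 * m by lia. rewrite h0 h1; nia.
- have -> : (4 * m + 2).-1 = 4 * m + 1 by lia. rewrite h1 h2; nia.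
- have -> : (4 * m + 3).-1 = 4 * m + 2 by lia. rewrite h2 h3; nia.
Qed.

Lemma sqr_lt_6h n : 3 < n -> n ^ 2 < 6 * h n.
Proof.
by have [m [] ->] := mod4_cases n; have [h0 h1 h2 h3] := h_4m m;
  rewrite ?h0 ?h1 ?h2 ?h3 -!mulnn => n3; nia.
Qed.

(** Parts of sizes 2p and 2q carry at most 4pq triangles, and for a fixed sum the product is largest
    when p and q differ by at most one. *)
Lemma h_even_even p q : 4 * p * q <= h (2 * p + 2 * q) /\
  (4 * p * q = h (2 * p + 2 * q) ->
   p = (2 * p + 2 * q + 1) %/ 4 \/ q = (2 * p + 2 * q + 1) %/ 4).
Proof.
wlog le_pq : p q / p <= q.
  move=> W; case: (leqP p q) => [/W//|/ltnW/W].
  by rewrite (addnC (2 * q)) mulnAC; tauto.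
have [d [] E] : exists d, q = p + 2 * d \/ q = p + 2 * d + 1.
  by exists ((q - p) %/ 2); lia.
- have [h0 _ _ _] := h_4m (p + d).
  have -> : 2 * p + 2 * q = 4 * (p + d) by lia.
  rewrite h0 E -!mulnn; split; first nia.
  by move=> H; (have : d = 0 by nia); lia.
- have [_ _ h2 _] := h_4m (p + d).
  have -> : 2 * p + 2 * q = 4 * (p + d) + 2 by lia.
  rewrite h2 E -!mulnn; split; first nia.
  by move=> H; (have : d = 0 by nia); lia.
Qed.

(** For parts of sizes 2p and 2q + 1 the optimum is p = q or p = q + 1, according to the order mod
    4; p = q - 1 falls short by one triangle. *)
Lemma h_even_odd p q : 4 * p * q + p <= h (2 * p + 2 * q + 1) /\
  (4 * p * q + p = h (2 * p + 2 * q + 1) -> p = (2 * p + 2 * q + 2) %/ 4).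
Proof.
have [d] : exists d, [\/ q = p + 2 * d, q = p + 2 * d + 1, p = q + 2 * d | p = q + 2 * d +
  1].
  exists (((q - p) + (p - q)) %/ 2).
  case: (leqP p q) => pq; case o: (odd (p + q));
    [apply: Or42|apply: Or41|apply: Or44|apply: Or43]; lia.
have [_ h1 _ h3] := h_4m (if p <= q then p + d else q + d).
case=> E; rewrite E in h1 h3 *.
- rewrite leq_addr ?(leq_trans (leq_addr _ _) (leq_addr _ _)) // in h1 h3.
  have -> : 2 * p + 2 * (p + 2 * d) + 1 = 4 * (p + d) + 1 by lia.
  by rewrite h1 -!mulnn; split; [nia|move=> H; (have : d = 0 by nia); lia].
- rewrite -addnA leq_addr in h1 h3.
  have -> : 2 * p + 2 * (p + 2 * d + 1) + 1 = 4 * (p + d) + 3 by lia.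
  rewrite h3 -!mulnn; split; first nia.
  by move=> H; exfalso; nia.
- case: d {E} h1 h3 => [|d]; last first.
    have -> : (q + 2 * d.+1 <= q) = false by lia.
    move=> h1 h3.
    have -> : 2 * (q + 2 * d.+1) + 2 * q + 1 = 4 * (q + d.+1) + 1 by lia.
    by rewrite h1 -!mulnn; split; [nia|move=> H; exfalso; nia].
  rewrite muln0 !addn0 leqnn => h1 _; have -> : 2 * q + 2 * q + 1 = 4 * q + 1 by lia.
  by rewrite h1 -!mulnn; split; [nia|lia].
- rewrite (_ : (q + 2 * d + 1 <= q) = false) in h1 h3; last by lia.
  have -> : 2 * (q + 2 * d + 1) + 2 * q + 1 = 4 * (q + d) + 3 by lia.
  by rewrite h3 -!mulnn; split; [nia|move=> H; (have : d = 0 by nia); lia].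
Qed.

Lemma h_odd_odd p q : 0 < p + q -> 4 * p * q + p + q < h (2 * p + 2 * q + 2).
Proof.
wlog le_pq : p q / p <= q.
  move=> W; case: (leqP p q) => [/W//|/ltnW/W].
  by rewrite (addnC (2 * q)) mulnAC (addnC q) => W' /W'; rewrite -!addnA (addnC q).
have [d [] E] : exists d, q = p + 2 * d \/ q = p + 2 * d + 1.
  by exists ((q - p) %/ 2); lia.
- have [_ _ h2 _] := h_4m (p + d).
  have -> : 2 * p + 2 * q + 2 = 4 * (p + d) + 2 by lia.
  by rewrite h2 E -!mulnn; nia.
- have [h0 _ _ _] := h_4m (p + d + 1).
  have -> : 2 * p + 2 * q + 2 = 4 * (p + d + 1) by lia.
  by rewrite h0 E -!mulnn; nia.
Qed.

(** Split by the parities of the parts; two odd parts never reach the maximum. The number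
    [2 * ((a + b + 1) %/ 4)] is the size of an even part of H(a + b), the smaller one if both are
    even. *)
Lemma h_parts a b : 2 < a + b ->
  b * a./2 + a * b./2 <= h (a + b) /\
  (b * a./2 + a * b./2 = h (a + b) ->
   a = 2 * ((a + b + 1) %/ 4) \/ b = 2 * ((a + b + 1) %/ 4)).
Proof.
have [p [q [i [j [Ea Eb]]]]] : exists p q (i j : bool), a = 2 * p + i /\ b = 2 * q + j.
  by exists a./2, b./2, (odd a), (odd b); lia.
have Hp : a./2 = p by case: i Ea => ->; lia.
have Hq : b./2 = q by case: j Eb => ->; lia.
rewrite {}Hp {}Hq {}Ea {}Eb => ab.
case: i ab; case: j => ab /=.
- have H := @h_odd_odd p q ltac:(lia).
  have -> : 2 * p + 1 + (2 * q + 1) = 2 * p + 2 * q + 2 by lia.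
  by split; [nia|move=> E; exfalso; nia].
- have [H1 H2] := h_even_odd q p.
  have -> : 2 * p + 1 + (2 * q + 0) = 2 * q + 2 * p + 1 by lia.
  split; first nia.
  by move=> E; right; have := H2 ltac:(nia); lia.
- have [H1 H2] := h_even_odd p q.
  have -> : 2 * p + 0 + (2 * q + 1) = 2 * p + 2 * q + 1 by lia.
  split; first nia.
  by move=> E; left; have := H2 ltac:(nia); lia.
- have [H1 H2] := h_even_even p q.
  have -> : 2 * p + 0 + (2 * q + 0) = 2 * p + 2 * q by lia.
  split; first nia.
  by move=> E; case: (H2 ltac:(nia)) => ?; [left|right]; lia.
Qed.

(* Accounting for the removal of a K4: [s1] and [s2] outside vertices see one and
   two of its vertices, and [m] of the latter have a neighbour seeing the same pair. *)
Lemma outside_arith T T' n s1 s2 m W :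
  T = T' + 24 + 6 * s2 + 6 * m + 3 * W -> ~~ odd m -> m <= s2 -> ~~ odd W -> W <= 3 * s1 ->
  s1 + s2 <= n -> T' <= 6 * h n ->
  T <= 6 * h (n + 4) /\
  (T = 6 * h (n + 4) -> T' = 6 * h n /\
    ([/\ s1 = 0, s2 = n & m + odd n = n] \/
     [/\ odd n, s1 = 1, s2 + 1 = n, m = s2 & W = 2])).
Proof.
rewrite h_add4; move: (h n) => hn -> m2 ms W2 Ws sn T'h.
split; first by lia.
move=> E; split; first by lia.
(* A vertex seeing one vertex of the K4 gives up two triangles and returns at most 3/2. So [s1 > 0]
   forces [n] odd and [s1 <= 2], and the parity of [m] excludes 2. *)
have [s10|s1p] := posnP s1; [left|right]; split; lia.
Qed.

Lemma h_extremal a b : a = 2 * ((a + b + 1) %/ 4) -> b * a./2 + a * b./2 = h (a + b).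
Proof.
have [m] := mod4_cases (a + b); have [h0 h1 h2 h3] := h_4m m.
case=> E; rewrite E ?h0 ?h1 ?h2 ?h3 => Ea.
- have [-> ->] : a = 2 * m /\ b = 2 * m by lia.
  by rewrite mul2n doubleK -!mulnn; nia.
- have [-> ->] : a = 2 * m /\ b = (2 * m).+1 by lia.
  by rewrite mul2n /= uphalf_double doubleK -!mulnn; nia.
- have [-> ->] : a = 2 * m /\ b = 2 * m.+1 by lia.
  by rewrite !mul2n !doubleK -!mulnn; nia.
- have [-> ->] : a = 2 * m.+1 /\ b = (2 * m).+1 by lia.
  by rewrite !mul2n !doubleK /= uphalf_double -!mulnn; nia.
Qed.

(** * Isomorphism and containment *)

Lemma isomorphic_refl (F : sgraph) : isomorphic F F.
Proof. by exists id; split=> //; exists id. Qed.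

Lemma isomorphic_sym (F F' : sgraph) : isomorphic F F' -> isomorphic F' F.
Proof.
case=> f [[g fK gK] fA]; exists g; split; first by exists f.
by move=> x y; rewrite -fA !gK.
Qed.

Lemma isomorphic_trans (F1 F2 F3 : sgraph) :
  isomorphic F1 F2 -> isomorphic F2 F3 -> isomorphic F1 F3.
Proof.
case=> f [bf fA] [g [bg gA]]; exists (g \o f); split; first exact: bij_comp.
by move=> x y /=; rewrite gA fA.
Qed.

Lemma contains_iso (G G' F : sgraph) : isomorphic G G' -> contains G F -> contains G' F.
Proof.
case=> f [bf fA] [g [ig gA]]; exists (f \o g); split; first exact: inj_comp (bij_inj bf) ig.
by move=> x y /gA; rewrite /= fA.
Qed.

Lemma contains_isor (G F F' : sgraph) : isomorphic F F' -> contains G F -> contains G F'.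
Proof.
case/isomorphic_sym => f [bf fA] [g [ig gA]]; exists (g \o f).
split; first exact: inj_comp ig (bij_inj bf).
by move=> x y xy; apply: gA; rewrite fA.
Qed.

Lemma is_free_iso P (G G' : sgraph) : isomorphic G G' -> is_free P G -> is_free P G'.
Proof. by move=> /isomorphic_sym i fG F PF /(contains_iso i); apply: fG. Qed.

Lemma val_ordS l (i : 'I_l) : ordS i = (if i.+1 < l then i.+1 else 0) :> nat.
Proof.
rewrite /=; case: ltnP => [lt|ge]; first by rewrite modn_small.
by rewrite (_ : i.+1 = l) ?modnn //; have := ltn_ord i; lia.
Qed.

Section Graph.
Variable G : sgraph.
Implicit Types (A B C D K P X Y : {set G}) (x y z c : G).

Local Notation e := (@adj G).
Local Notation edges := (arcs (@adj G)).
Local Notation nbr := (nbhd (@adj G)).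

Let e_sym : symmetric e := @adj_sym G.
Let e_irr : irreflexive e := @adj_irr G.

Lemma adj_neq x y : adj x y -> x != y.
Proof. by apply: contraTneq => ->; rewrite e_irr. Qed.

(** * Triangles counted as ordered triples *)

Definition tri A B C : nat :=
  \sum_(x in A) \sum_(y in B) \sum_(z in C) [&& adj x y, adj y z & adj x z].

Lemma triC12 A B C : tri A B C = tri B A C.
Proof.
rewrite /tri exchange_big; apply: eq_bigr => x _; apply: eq_bigr => y _.
apply: eq_bigr => z _; rewrite (e_sym y x).
by case: (adj x y); case: (adj x z); case: (adj y z).
Qed.

Lemma triC23 A B C : tri A B C = tri A C B.
Proof.
apply: eq_bigr => x _; rewrite exchange_big; apply: eq_bigr => y _.
apply: eq_bigr => z _; rewrite (e_sym z y).
by case: (adj x y); case: (adj x z); case: (adj y z).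
Qed.

Lemma triUl A B C D : [disjoint A & B] -> tri (A :|: B) C D = tri A C D + tri B C D.
Proof. exact: sum_setU. Qed.

Lemma triUUU A B : [disjoint A & B] ->
  tri (A :|: B) (A :|: B) (A :|: B) =
  tri A A A + tri B B B + 3 * tri A A B + 3 * tri A B B.
Proof.
move=> d; have U2 C D : tri C (A :|: B) D = tri C A D + tri C B D.
  by rewrite triC12 triUl // !(triC12 _ C).
have U3 C D : tri C D (A :|: B) = tri C D A + tri C D B.
  by rewrite triC23 U2 !(triC23 _ _ D).
rewrite triUl // !U2 !U3 (triC12 B A A) (triC23 A B A) (triC12 B A B) (triC23 B B A)
  (triC12 B A B).
by lia.
Qed.

Lemma tri1l x B : tri [set x] B B = edges (nbr B x) (nbr B x).
Proof.
rewrite /tri big_set1 /arcs [RHS]big_mkcond [LHS]big_mkcond; apply: eq_bigr => y _.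
rewrite inE; case: (y \in B) => //=; case: (adj x y) => /=; last by rewrite big1.
rewrite [RHS]big_mkcond [LHS]big_mkcond; apply: eq_bigr => z _; rewrite inE.
by case: (z \in B) => //=; case: (adj x z); rewrite ?andbF ?andbT.
Qed.

Lemma triE A B : tri A B B = \sum_(x in A) edges (nbr B x) (nbr B x).
Proof. by apply: eq_bigr => x _; rewrite -tri1l /tri big_set1. Qed.

Definition clique K := {in K &, forall x y, x != y -> adj x y}.

Lemma clique_nbr K x : clique K -> x \in K -> nbr K x = K :\ x.
Proof.
move=> cK xK; apply/setP => y; rewrite !inE; have [->|yx] := eqVneq y x;
  first by rewrite e_irr andbF.
by case yK: (y \in K) => //=; apply: cK => //; rewrite eq_sym.
Qed.

Lemma clique_edges K : clique K -> edges K K = #|K| * #|K|.-1.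
Proof.
move=> cK; rewrite arcsE -sum_nat_const; apply: eq_bigr => x xK.
by rewrite clique_nbr // (cardsD1 x K) xK.
Qed.

Lemma clique_tri K : clique K -> tri K K K = #|K| * (#|K|.-1 * #|K|.-2).
Proof.
move=> cK; rewrite triE -sum_nat_const; apply: eq_bigr => x xK.
rewrite clique_nbr // clique_edges ?(cardsD1 x K) ?xK //.
by move=> y z; rewrite !inE => /andP[_ yK] /andP[_ zK]; apply: cK.
Qed.

Definition K4 K := #|K| = 4 /\ {in K &, forall x y, x != y -> adj x y}.

Lemma tri_triangles : tri setT setT setT = 6 * #|triangles G|.
Proof.
have tri6 (T : {set G}) : T \in triangles G -> tri T T T = 6.
  rewrite inE => /andP[/eqP T3 /forall_inP aT]; rewrite clique_tri ?T3 //.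
  by move=> x y xT yT; move/forall_inP: (aT x xT) => /(_ y yT)/implyP.
rewrite mulnC -sum_nat_const.
under [RHS]eq_bigr => T TT do rewrite -(tri6 T TT).
(* Double counting of triangles with an ordering: after exchanging the sums, an ordered triple of
   pairwise adjacent vertices lies in exactly one triangle, [[set x; y; z]]. *)
pose F (T : {set G}) x y z := [&& x \in T, y \in T, z \in T & [&& adj x y, adj y z & adj x
  z]].
have triF (T : {set G}) : tri T T T = \sum_x \sum_y \sum_z F T x y z.
  rewrite /tri [LHS]big_mkcond; apply: eq_bigr => x _; rewrite /F.
  case: (x \in T) => /=; last by rewrite !big1 // => y _; rewrite big1.
  rewrite [LHS]big_mkcond; apply: eq_bigr => y _.
  case: (y \in T) => /=; last by rewrite !big1.
  by rewrite [LHS]big_mkcond; apply: eq_bigr => z _; case: (z \in T).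
under [RHS]eq_bigr => T _ do rewrite triF.
rewrite triF [RHS]exchange_big; apply: eq_bigr => x _ /=.
rewrite [RHS]exchange_big; apply: eq_bigr => y _ /=.
rewrite [RHS]exchange_big; apply: eq_bigr => z _ /=.
rewrite {1}/F !inE /= sum_card; case a: [&& _, _ & _]; last first.
  apply/esym/eqP; rewrite cards_eq0; apply/eqP/setP => T; rewrite inE in_set0 /F a.
  by rewrite !andbF.
transitivity #|[set [set x; y; z]]|; first by rewrite cards1.
apply: eq_card => T; rewrite in_set1 [in RHS]inE /F a andbT.
case/and3P: a => xy yz xz.
have c3 : #|[set x; y; z]| = 3.
  by rewrite -setUA !cardsU1 cards1 !inE negb_or (adj_neq xy) (adj_neq xz) (adj_neq yz).
apply/eqP/andP => [->|[TT /and3P[xT yT zT]]].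
  split; last by rewrite !inE !eqxx ?orbT.
  rewrite inE c3 eqxx /=; apply/forall_inP => s; rewrite !inE -orbA => sT.
  apply/forall_inP => t; rewrite !inE -orbA; move: sT.
  by move=> /or3P[]/eqP-> /or3P[]/eqP->;
    rewrite ?eqxx ?xy ?yz ?xz ?implybT // adj_sym ?xy ?yz ?xz implybT.
apply/eqP; rewrite eq_sym eqEcard c3; move: TT; rewrite inE => /andP[/eqP-> _];
  rewrite andbT.
by apply/subsetP => t; rewrite !inE -orbA => /or3P[]/eqP->.
Qed.

Lemma tri_isolated D x : x \in D -> nbr D x = set0 ->
  tri D D D = tri (D :\ x) (D :\ x) (D :\ x).
Proof.
move=> xD N0; rewrite -[in LHS](setD1K xD) triUUU ?disjoints1 ?inE ?eqxx //.
have N' : nbr (D :\ x) x = set0.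
  apply/setP => y; rewrite !inE; have /setP/(_ y) := N0; rewrite !inE => N.
  by rewrite -andbA N andbF.
have xx : nbr [set x] x = set0.
  by apply/setP => y; rewrite !inE; case: eqP => // ->; rewrite e_irr.
have e0 : edges set0 set0 = 0 by rewrite /arcs big_set0.
have -> : tri [set x] [set x] [set x] = 0 by rewrite tri1l xx.
have -> : tri [set x] (D :\ x) (D :\ x) = 0 by rewrite tri1l N'.
suff -> : tri [set x] [set x] (D :\ x) = 0 by lia.
rewrite triC23 triC12 triE big1 // => y; rewrite !inE => /andP[_ yD].
have -> // : nbr [set x] y = set0.
apply/setP => z; rewrite !inE; case: eqP => // ->.
by have /setP/(_ y) := N0; rewrite !inE yD e_sym.
Qed.

(** * Vertex sets that induce a matching, and their joins *)

Definition low A := forall x y z, x \in A -> y \in A -> z \in A -> adj x y -> adj x z -> y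
  = z.

Lemma low_nbr_le1 A x : low A -> x \in A -> #|nbr A x| <= 1.
Proof.
move=> lA xA; rewrite leqNgt; apply/negP => /card_gt1P[y [z [xy xz]]].
move: xy xz; rewrite inE => /andP[yA xy]; rewrite inE => /andP[zA xz].
by rewrite (lA x y z xA yA zA xy xz) eqxx.
Qed.

Lemma low_edges_le A : low A -> edges A A <= 2 * #|A|./2.
Proof.
move=> lA; have : edges A A <= #|A|.
  by rewrite arcsE -sum1_card; apply: leq_sum => x; apply: low_nbr_le1.
by have := arcs_even e_sym e_irr A; lia.
Qed.

Lemma low_perfect A x : low A -> edges A A = #|A| -> x \in A ->
  exists2 y, y \in A & adj x y.
Proof.
move=> lA EA xA; have [N0|[y]] := set_0Vmem (nbr A x); last first.
  by rewrite inE => /andP[yA xy]; exists y.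
suff : edges A A < #|A| by rewrite EA ltnn.
rewrite arcsE -sum1_card (bigD1 x) //= [X in _ < X](bigD1 x) //= N0 cards0.
by rewrite add0n add1n ltnS; apply: leq_sum => t /andP[tA _]; apply: low_nbr_le1.
Qed.

Lemma low_tri A : low A -> tri A A A = 0.
Proof.
move=> lA; apply: big1 => x xA; apply: big1 => y yA; apply: big1 => z zA.
apply/eqP; rewrite eqb0; apply/negP => /and3P[xy yz xz].
by move: yz; rewrite (lA x y z xA yA zA xy xz) e_irr.
Qed.

Lemma arcsS A B : A \subset B -> edges A A <= edges B B.
Proof.
move=> sAB; rewrite -(setID B A) (setIidPr sAB) arcsUU //; first by lia.
by rewrite -setI_eq0 setIDA setIC setDIl setDv setI0.
Qed.

Lemma tri_low A B : tri B A A <= #|B| * edges A A.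
Proof.
rewrite triE -sum_nat_const; apply: leq_sum => z _; apply: arcsS.
by apply/subsetP => x; rewrite inE => /andP[].
Qed.

(* [A] and [B] are the parts of a complete bipartite graph with a maximum
   matching added inside each part. *)
Definition joined A B := [/\ [disjoint A & B], low A, low B,
  forall x y, x \in A -> y \in B -> adj x y &
  edges A A = 2 * #|A|./2 /\ edges B B = 2 * #|B|./2].

Lemma joinedC A B : joined A B -> joined B A.
Proof.
move=> [d lA lB c [eA eB]]; split=> //; first by rewrite disjoint_sym.
by move=> x y xB yA; rewrite e_sym c.
Qed.

Lemma triU_low A B : [disjoint A & B] -> low A -> low B ->
  tri (A :|: B) (A :|: B) (A :|: B) = 3 * (tri B A A + tri A B B).
Proof.
move=> d lA lB; rewrite triUUU // !low_tri // (triC23 A A B) triC12; lia.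
Qed.

(** The estimates [tri_low], [low_edges_le] and [h_parts] must all be equalities. So both matchings
    are maximum, and each edge in the even part forms a triangle with every vertex of the other
    part. The even part is perfectly matched, hence the join is complete. *)
Lemma low_max A B : [disjoint A & B] -> low A -> low B -> 2 < #|A| + #|B| ->
  tri (A :|: B) (A :|: B) (A :|: B) = 6 * h (#|A| + #|B|) ->
  (#|A| = 2 * ((#|A| + #|B| + 1) %/ 4) \/ #|B| = 2 * ((#|A| + #|B| + 1) %/ 4)) /\
  joined A B.
Proof.
wlog Aeven : A B / (#|A| = 2 * ((#|A| + #|B| + 1) %/ 4)).
  move=> W d lA lB n3 E; have [le eq] := h_parts n3.
  have := tri_low A B; have := tri_low B A; have := low_edges_le lA;
    have := low_edges_le lB.
  move=> eB eA tB tA; rewrite triU_low // in E.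
  have [] := eq ltac:(nia) => [Ae|Be]; first by apply: W => //; rewrite triU_low.
  rewrite disjoint_sym in d; rewrite addnC in n3.
  have EBA : tri (B :|: A) (B :|: A) (B :|: A) = 6 * h (#|B| + #|A|).
    by rewrite triU_low // addnC E addnC.
  have BA : #|B| = 2 * ((#|B| + #|A| + 1) %/ 4) by rewrite (addnC #|B|).
  have [] := W B A BA d lB lA n3 EBA.
  by rewrite (addnC #|B|) => sz /joinedC; split=> //; tauto.
move=> d lA lB n3; rewrite triU_low // => E; have [le eq] := h_parts n3.
have := tri_low A B; have := tri_low B A; have := low_edges_le lA; have := low_edges_le lB.
move=> eB eA tB tA.
have A0 : 0 < #|A| by lia.
have B0 : 0 < #|B| by lia.
have fA : #|B| * edges A A <= #|B| * (2 * #|A|./2) by rewrite leq_mul2l eA orbT.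
have fB : #|A| * edges B B <= #|A| * (2 * #|B|./2) by rewrite leq_mul2l eB orbT.
have EA : edges A A = 2 * #|A|./2.
  by apply/eqP; rewrite -(eqn_pmul2l B0); apply/eqP; nia.
have EB : edges B B = 2 * #|B|./2.
  by apply/eqP; rewrite -(eqn_pmul2l A0); apply/eqP; nia.
have tE : tri B A A = #|B| * edges A A by nia.
split; first by left.
split=> // x z xA zB; rewrite e_sym.
have [x' x'A xx'] : exists2 x', x' \in A & adj x x'.
  by apply: low_perfect => //; rewrite EA; lia.
apply: contraTT isT => zx.
suff : tri B A A < #|B| * edges A A by rewrite tE ltnn.
rewrite triE -sum_nat_const (bigD1 z) //= [X in _ < X](bigD1 z) //=.
rewrite -addSn leq_add //; last first.
  by apply: leq_sum => t _; apply: arcsS; apply/subsetP => s; rewrite inE => /andP[].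
(* The neighbours of [z] in [A] avoid [x], so the link of [z] loses the edge from [x] to its partner
   [x']. *)
apply: (@leq_ltn_trans (edges (A :\ x) (A :\ x))).
  apply: arcsS; apply/subsetP => t; rewrite !inE => /andP[-> zt]; rewrite andbT.
  by apply: contraTneq zt => ->.
rewrite [X in _ < X](arcsD1 e_sym e_irr xA) -[X in X < _]addn0 ltn_add2l muln_gt0 /=.
by apply/card_gt0P; exists x'; rewrite inE x'A.
Qed.

Lemma low_small A : #|A| <= 2 -> low A.
Proof.
move=> A2 x y z xA yA zA xy xz; apply/eqP; apply: contraT => yz.
suff : 2 < #|A| by rewrite ltnNge A2.
by apply/card_gt2P; exists x, y, z; split; split=> //; rewrite 1?eq_sym adj_neq // e_sym.
Qed.

(** For at least three vertices, [D] induces a copy of H(n) with [A] as the part chosen in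
    [h_parts]. *)
Definition extremal_split D := exists A B,
  [/\ D = A :|: B, #|A| = 2 * ((#|D| + 1) %/ 4) & joined A B].

Lemma low_extremal A B D : D = A :|: B -> [disjoint A & B] -> low A -> low B ->
  2 < #|D| -> tri D D D = 6 * h #|D| -> extremal_split D.
Proof.
move=> DE d lA lB D3 E.
have cD : #|D| = #|A| + #|B| by rewrite DE cardsU disjoint_setI0 // cards0 subn0.
have n3 : 2 < #|A| + #|B| by rewrite -cD.
have [|sz j] := low_max d lA lB n3; first by rewrite -DE E cD.
rewrite -cD in sz; case: sz => sz; [exists A, B | exists B, A]; split => //.
  by rewrite setUC.
exact: joinedC.
Qed.

Lemma joined_tri A B : joined A B ->
  tri (A :|: B) (A :|: B) (A :|: B) = 6 * (#|B| * #|A|./2 + #|A| * #|B|./2).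
Proof.
have half X Y : joined X Y -> tri Y X X = 2 * (#|Y| * #|X|./2).
  move=> [_ _ _ cXY [eX _]]; rewrite triE mulnCA -eX -sum_nat_const.
  apply: eq_bigr => y yY; have -> // : nbr X y = X.
  by apply/setP => x; rewrite inE; case xX: (x \in X) => //=; rewrite e_sym cXY.
move=> j; have [d lA lB _ _] := j.
by rewrite triU_low // (half A B) // (half B A (joinedC j)); lia.
Qed.

(** At most one vertex is unmatched, so the arcs number at least [#|A| - 1]; being even in number,
    they reach the maximum. *)
Lemma low_edges_max A : low A ->
  {in A &, forall x y, nbr A x = set0 -> nbr A y = set0 -> x = y} ->
  edges A A = 2 * #|A|./2.
Proof.
move=> lA uniqA; have := low_edges_le lA.
suff : #|A| <= edges A A + 1 by have := arcs_even e_sym e_irr A; lia.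
have : #|[set x in A | nbr A x == set0]| <= 1.
  apply/card_le1_eqP => x y; rewrite !inE => /andP[xA /eqP Nx] /andP[yA /eqP Ny].
  exact: uniqA.
suff : #|A| <= edges A A + #|[set x in A | nbr A x == set0]| by lia.
rewrite arcsE -sum_card -big_split -sum1_card; apply: leq_sum => x _ /=.
by case: eqP => [->|/eqP]; rewrite ?addn1 // addn0 card_gt0.
Qed.

(** Lists the matched pairs one after another and a possible unmatched vertex last, so that
    positions pair up as in [H2]. *)
Lemma low_seq A x0 : low A -> edges A A = 2 * #|A|./2 ->
  exists s, [/\ uniq s, s =i A & forall i j, i < size s -> j < size s ->
    adj (nth x0 s i) (nth x0 s j) = (i != j) && (i./2 == j./2)].
Proof.
have [n] := ubnP #|A|; elim: n A => // n IH A ltA lA eA.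
have [A1|A2] := leqP #|A| 1.
  exists (enum A); split; [exact: enum_uniq|exact: mem_enum|].
  rewrite -cardE => i j; case: i j => [|i] [|j]; rewrite ?e_irr //; lia.
have [x xA [y yA xy]] : exists2 x, x \in A & exists2 y, y \in A & adj x y.
  have : 0 < edges A A by rewrite eA; lia.
  rewrite lt0n sum_nat_eq0 => /forallPn[x]; rewrite negb_imply => /andP[xA].
  rewrite sum_nat_eq0 => /forallPn[y]; rewrite negb_imply eqb0 negbK => /andP[yA xy].
  by exists x => //; exists y.
have yx : y != x by rewrite eq_sym adj_neq.
pose A' := A :\ x :\ y.
have sA t : t \in A' -> [/\ t \in A, t != x & t != y] by rewrite !inE => /and3P[].
have Nx t : t \in A -> adj x t = (t == y).
  by move=> tA; apply/idP/eqP => [xt|->//]; apply: (lA x).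
have Ny t : t \in A -> adj y t = (t == x).
  move=> tA; apply/idP/eqP => [yt|->]; last by rewrite e_sym.
  by apply: (lA y) => //; rewrite e_sym.
have yA' : y \in A :\ x by rewrite !inE yx.
have cA : #|A| = #|A'| + 2.
  by have := cardsD1 x A; have := cardsD1 y (A :\ x); rewrite xA yA' -/A'; lia.
have eA' : edges A' A' = 2 * #|A'|./2.
  move: eA; rewrite (arcsD1 e_sym e_irr xA) (arcsD1 e_sym e_irr yA').
  have -> : nbr A x = [set y].
    by apply/setP => t; rewrite !inE; case tA: (t \in A); rewrite /= ?Nx //;
      case: eqP => // E; rewrite -E tA in yA.
  have -> : nbr (A :\ x) y = set0.
    apply/setP => t; rewrite !inE; case tA: (t \in A); rewrite ?andbF //= Ny //.
    by rewrite andbT andNb.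
  by rewrite cards0 cards1 cA -/A'; lia.
have lA' : low A'.
  by move=> s t r /sA[sA' _ _] /sA[tA' _ _] /sA[rA' _ _]; apply: lA.
have [|s [us sE sadj]] := IH A' _ lA' eA'; first by lia.
have sS t : t \in s -> [/\ t \in A, t != x & t != y] by rewrite sE => /sA.
exists (x :: y :: s); split.
- rewrite /= inE negb_or eq_sym yx us andbT /=.
  by apply/andP; split; apply/negP => /sS[_]; rewrite eqxx.
- move=> t; rewrite !inE sE !inE.
  have [->|tx] := eqVneq t x; first by rewrite xA.
  by have [->|ty] := eqVneq t y; first rewrite yA.
have xs i : i < size s -> adj x (nth x0 s i) = false.
  by move=> /(mem_nth x0)/sS[tA _ ty]; rewrite Nx // (negbTE ty).
have ys i : i < size s -> adj y (nth x0 s i) = false.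
  by move=> /(mem_nth x0)/sS[tA tx _]; rewrite Ny // (negbTE tx).
move=> [|[|i]] [|[|j]] //= li lj; rewrite ?e_irr //.
- by rewrite xs.
- by rewrite e_sym.
- by rewrite ys.
- by rewrite e_sym xs.
- by rewrite e_sym ys.
- by rewrite sadj.
Qed.

Lemma joined_iso A B x0 : A :|: B = setT -> joined A B -> isomorphic G (H2 #|A| #|B|).
Proof.
move=> AB [d lA lB cAB [eA eB]].
have [s [us sA sadj]] := low_seq x0 lA eA.
have [t [ut tB tadj]] := low_seq x0 lB eB.
have ss : size s = #|A| by rewrite -(card_uniqP us); apply: eq_card.
have st : size t = #|B| by rewrite -(card_uniqP ut); apply: eq_card.
have sin (i : 'I_#|A|) : nth x0 s i \in A by rewrite -sA mem_nth // ss.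
have tin (i : 'I_#|B|) : nth x0 t i \in B by rewrite -tB mem_nth // st.
have ABneq x y : x \in A -> y \in B -> (x == y) = false.
  by move=> xA yB; apply/eqP => E; rewrite -E (disjointFr d xA) in yB.
apply: isomorphic_sym.
exists (fun u : H2 #|A| #|B| => match u with inl i => nth x0 s i | inr i => nth x0 t i end).
split.
  apply: inj_card_bij.
    move=> [i|i] [j|j] /eqP.
    - by rewrite nth_uniq ?ss // => /eqP/val_inj->.
    - by rewrite (ABneq _ _ (sin i) (tin j)).
    - by rewrite eq_sym (ABneq _ _ (sin j) (tin i)).
    - by rewrite nth_uniq ?st // => /eqP/val_inj->.
  by rewrite card_sum !card_ord -cardsT -AB cardsU disjoint_setI0 // cards0 subn0.
move=> [i|i] [j|j]; rewrite /= /simple_closure /=.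
- by rewrite sadj ?ss // (eq_sym j./2) orbb.
- by rewrite cAB.
- by rewrite adj_sym cAB.
- by rewrite tadj ?st // (eq_sym j./2) orbb.
Qed.

(** * Wheels as cycles in links *)

Definition wheel_free := forall c, cactus e (nbr setT c).

Lemma cycle_nth (s : seq G) x0 (i : 'I_(size s)) : cycle (@adj G) s ->
  adj (nth x0 s i) (nth x0 s (ordS i)).
Proof.
rewrite val_ordS; case: s i => [|a s] [i] //= lti /(pathP x0) ep.
have := ep i; rewrite size_rcons => /(_ lti).
rewrite -rcons_cons !nth_rcons /= lti ltnS.
case: (ltnP i (size s)) => // le; have -> : i = size s by lia.
by rewrite eqxx.
Qed.

Lemma free_wheel_free : is_free wheels_ge4 G -> wheel_free.
Proof.
move=> fG c s us es sub; rewrite leqNgt; apply/negP => s4.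
apply: (fG (wheel (size s))); first by exists (size s) => //; apply: isomorphic_refl.
have cs (i : 'I_(size s)) : adj c (nth c s i).
  by have := sub _ (mem_nth c (ltn_ord i)); rewrite !inE.
have step (i j : 'I_(size s)) : adj (i : cycle_graph (size s)) j -> adj (nth c s i) (nth c
  s j).
  by move=> /andP[_ /orP[]/eqP->]; last rewrite adj_sym; apply: cycle_nth.
exists (fun o : wheel (size s) => if o is Some i then nth c s i else c); split.
  move=> [i|] [j|] //= E.
  - by congr Some; apply/val_inj/eqP; rewrite -(nth_uniq c (ltn_ord i) (ltn_ord j) us) E.
  - by have := cs i; rewrite E adj_irr.
  - by have := cs j; rewrite -E adj_irr.
move=> [i|] [j|] // /andP[ne /orP[]] //= ij; try by rewrite // adj_sym.
- exact: step.
- by rewrite adj_sym step.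
Qed.

(** At most one rim vertex lies in the part of the hub. On a rim of length at least 4 the next three
    vertices form a path in the other part, whose middle vertex has two neighbours there. *)
Lemma low_free A B : A :|: B = setT -> low A -> low B -> is_free wheels_ge4 G.
Proof.
move=> AB lA lB F [l l4 iF] /(contains_isor iF) {F iF} [f [fi fh]].
wlog cA : A B AB lA lB / f None \in A.
  move=> W; have : f None \in A :|: B by rewrite AB inE.
  by rewrite inE => /orP[]; [exact: W AB lA lB|apply: W lB lA; rewrite setUC].
have rim (i : 'I_l) : adj (f None) (f (Some i)) by apply: fh.
have succ (i : 'I_l) : adj (f (Some i)) (f (Some (ordS i))).
  apply: fh; rewrite /= /simple_closure /= eqxx andbT.
  suff E : i != ordS i by apply/andP; split; [exact: E|rewrite E].
  apply/eqP => /(congr1 (@nat_of_ord l)); rewrite val_ordS; have := ltn_ord i; move: l4;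
    clear; move: (i : nat) => k l4 kl; case: ltnP; lia.
(* If no rim vertex shares the part of the hub, any index serves; 0 is taken. *)
have [j jA] : exists j : 'I_l, forall i, f (Some i) \in A -> i = j.
  have [/existsP[j jA]|/existsPn noA] := boolP [exists j : 'I_l, f (Some j) \in A].
    by exists j => i iA; have [] := fi _ _ (lA _ _ _ cA iA jA (rim i) (rim j)).
  by exists (Ordinal (leq_trans (isT : 0 < 4) l4)) => i; rewrite (negbTE (noA i)).
have inB i : i != j -> f (Some i) \in B.
  have : f (Some i) \in A :|: B by rewrite AB inE.
  by rewrite inE => /orP[/jA->|//]; rewrite eqxx.
pose i1 := ordS j; pose i2 := ordS i1; pose i3 := ordS i2.
have ltj := ltn_ord j.
have v1 : i1 = (if j.+1 < l then j.+1 else 0) :> nat := val_ordS j.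
have v2 : i2 = (if i1.+1 < l then i1.+1 else 0) :> nat := val_ordS i1.
have v3 : i3 = (if i2.+1 < l then i2.+1 else 0) :> nat := val_ordS i2.
have ne (i k : 'I_l) : (i : nat) != k -> i != k by rewrite -val_eqE.
have [/ne n1 /ne n2 /ne n3 /ne n13] : [/\ (i1 : nat) != j, (i2 : nat) != j, (i3 : nat) != j
  & (i1 : nat) != i3].
  move: v1 v2 v3 ltj; move: (j : nat) (i1 : nat) (i2 : nat) (i3 : nat) => a b c d.
  by move: l4; clear; case: (ltnP a.+1 l); case: (ltnP b.+1 l); case: (ltnP c.+1 l) => *;
    split; lia.
have s1 : adj (f (Some i2)) (f (Some i1)) by rewrite adj_sym; apply: succ.
case/eqP: n13; apply: Some_inj; apply: fi.
exact: lB (inB _ n2) (inB _ n1) (inB _ n3) s1 (succ i2).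
Qed.

Lemma sub_class P K : K4 K -> exists2 P : {set G}, P \subset K & #|P| = 2.
Proof.
move=> [K4 _]; have : 1 < #|K| by rewrite K4.
case/card_gt1P => x [y [xK yK xy]]; exists [set x; y]; last by rewrite cards2 xy.
by apply/subsetP => t; rewrite !inE => /orP[]/eqP->.
Qed.

(** * Links, the edge bound and K4-free sets *)

Hypothesis wf : wheel_free.

Lemma link_cycle c s : uniq s -> cycle e s -> {in s, forall x, adj c x} -> size s <= 3.
Proof. by move=> us es cs; apply: (@wf c s us es) => x /cs cx; rewrite !inE. Qed.

Lemma no_wheel4 c p q r s : adj c p -> adj c q -> adj c r -> adj c s ->
  adj p q -> adj q r -> adj r s -> adj s p -> p != r -> q != s -> False.
Proof.
move=> cp cq cr cs pq qr rs sp npr nqs.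
have ne x y : adj x y -> x != y by apply: contraTneq => ->; rewrite e_irr.
suff: size [:: p; q; r; s] <= 3 by [].
apply: (@link_cycle c).
- by rewrite /= !inE !negb_or npr nqs (ne p q) // (ne q r) // (ne r s) // eq_sym (ne s p).
- by rewrite /= pq qr rs sp.
- by move=> x; rewrite !inE => /or4P[]/eqP->.
Qed.

Lemma cactus_link D c : cactus e (nbr D c).
Proof. by apply: (cactusS _ (@wf c)); apply/subsetP => x; rewrite !inE => /andP[_ ->]. Qed.

(** A triangle in the link of [c] would form a K4 with [c], so the link is a forest. *)
Lemma K4_free_forest D c : (forall K, K \subset D -> ~ K4 K) -> c \in D ->
  nbr D c != set0 -> edges (nbr D c) (nbr D c) + 2 <= 2 * #|nbr D c|.
Proof.
move=> noK cD N0; apply: cactus_arcs => //; first exact: cactus_link.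
right; split=> // x y z; rewrite !inE => /andP[xD cx] /andP[yD cy] /andP[zD cz] xy yz xz.
apply: (noK [set c; x; y; z]).
  by apply/subsetP => t; rewrite !inE => /orP[/orP[/orP[]|]|] /eqP->.
split.
  have -> : [set c; x; y; z] = [set t in [:: c; x; y; z]].
    by apply/setP => t; rewrite !inE !orbA.
  rewrite cardsE; apply/card_uniqP.
  by rewrite /= !inE !negb_or (adj_neq cx) (adj_neq cy) (adj_neq cz) (adj_neq xy) (adj_neq
    xz) (adj_neq yz).
move=> s t; rewrite !inE -!orbA => /or4P[]/eqP-> /or4P[]/eqP->; rewrite ?eqxx // => _;
  by rewrite // e_sym.
Qed.

(* The triangles are at most [2 * edges D D] because links are forests, and at
   least the sum of [d(x) + d(y) - n] over the arcs [(x, y)]. *)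
Lemma K4_free_edges D : (forall K, K \subset D -> ~ K4 K) ->
  2 * edges D D <= #|D| ^ 2 + 2 * #|D|.
Proof.
move=> noK.
have leT : tri D D D <= 2 * edges D D.
  rewrite triE arcsE big_distrr /=; apply: leq_sum => c cD.
  have [->|N0] := eqVneq (nbr D c) set0; first by rewrite /arcs big_set0.
  by have := K4_free_forest noK cD N0; lia.
have geT : 2 * \sum_(x in D) #|nbr D x| ^ 2 <= tri D D D + #|D| * edges D D.
  have -> : 2 * (\sum_(x in D) #|nbr D x| ^ 2) =
      \sum_(x in D) \sum_(y in D) adj x y * (#|nbr D x| + #|nbr D y|).
    transitivity (\sum_(x in D) \sum_(y in D) adj x y * #|nbr D x| +
                  \sum_(x in D) \sum_(y in D) adj x y * #|nbr D y|).
      have E : \sum_(x in D) \sum_(y in D) adj x y * #|nbr D x| = \sum_(x in D) #|nbr D x|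
        ^ 2.
        by apply: eq_bigr => x _; rewrite -big_distrl /= sum_card mulnn.
      rewrite mul2n -addnn -{1}E -E; congr (_ + _); rewrite exchange_big.
      by apply: eq_bigr => x _; apply: eq_bigr => y _; rewrite e_sym.
    by rewrite -big_split; apply: eq_bigr => x _; rewrite -big_split;
      apply: eq_bigr => y _; rewrite mulnDr.
  rewrite /tri /arcs big_distrr -big_split; apply: leq_sum => x xD /=.
  rewrite big_distrr -big_split; apply: leq_sum => y yD /=.
  case xy: (adj x y); last by rewrite mul0n.
  rewrite mul1n muln1 /= sum_card.
  (* The two degrees add up to the number of common neighbours, which complete the arc to triangles,
     plus the size of the union, at most [#|D|]. *)
  rewrite -cardsUI addnC leq_add ?subset_leq_card //.
    by apply/subsetP => z; rewrite !inE => /andP[/andP[-> ->] /andP[_ ->]].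
  by apply/subsetP => z; rewrite !inE => /orP[]/andP[].
have CS : edges D D ^ 2 <= #|D| * \sum_(x in D) #|nbr D x| ^ 2.
  rewrite arcsE -(leq_pmul2l (isT : 0 < 2)) -mulnn big_distrl big_distrr /=.
  apply: (@leq_trans (\sum_(x in D) \sum_(y in D) (#|nbr D x| ^ 2 + #|nbr D y| ^ 2))).
    apply: leq_sum => x _; rewrite big_distrr big_distrr /=; apply: leq_sum => y _.
    exact: nat_Cauchy.
  rewrite (eq_bigr (fun x => #|D| * #|nbr D x| ^ 2 + \sum_(y in D) #|nbr D y| ^ 2)) => [|x
    _].
    by rewrite big_split /= -big_distrr /= sum_nat_const; lia.
  by rewrite big_split /= sum_nat_const.
move: leT geT CS.
move: (edges D D) (tri D D D) (\sum_(x in D) _) #|D| => E T S n.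
case: (posnP E) => [->|E0] *; first by lia.
(* The three bounds chain to 2E^2 <= 2nS <= n(T + nE) <= n(n + 2)E, and E cancels. *)
rewrite -(leq_pmul2r E0); nia.
Qed.

(** If [y] saw [x1], [x2], [x3], with [x4] the fourth vertex of [K], then [y], [x2], [x4], [x3]
    would be a 4-cycle around [x1]. *)
Lemma K4_nbr_le2 K y : K4 K -> y \notin K -> #|nbr K y| <= 2.
Proof.
move=> [K4 cK] yK; rewrite leqNgt; apply/negP => /card_gt2P[x1 [x2 [x3]]].
rewrite !inE => -[[/andP[x1K yx1] /andP[x2K yx2] /andP[x3K yx3]] [n12 n23 n31]].
have [x4] : exists x4, x4 \in K :\: [set x1; x2; x3].
  apply/set0Pn; rewrite -card_gt0 cardsD K4.
  have := subset_leq_card (subsetIr K [set x1; x2; x3]).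
  have : #|[set x1; x2; x3]| <= 3 by rewrite -setUA !cardsU1 cards1;
    do 2 case: (_ \notin _).
  by lia.
rewrite !inE !negb_or => /andP[/andP[/andP[n41 n42] n43] x4K].
apply: (@no_wheel4 x1 y x2 x4 x3) => //.
- by rewrite e_sym.
- exact: cK.
- by apply: cK => //; rewrite eq_sym.
- by apply: cK => //; rewrite eq_sym.
- by apply: cK => //; rewrite eq_sym.
- exact: cK.
- by rewrite e_sym.
- by apply: contraNneq yK => ->.
Qed.

(** Removing a K4 from m further vertices loses at most 12 + 4m arcs, and twice that is exactly the
    growth of the right-hand side. *)
Lemma edge_bound D : 2 * edges D D <= #|D| ^ 2 + 2 * #|D|.
Proof.
have [n] := ubnP #|D|; elim: n D => // n IH D ltD.
have [noK|/existsNP[K /not_implyP[KD /contrapT KK]]] := pselect (forall K, K \subset D -> ~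
  K4 K).
  exact: K4_free_edges.
have dj : [disjoint D :\: K & K] by rewrite -setI_eq0 setIDAC setDIl setDv setI0.
have DE : D = (D :\: K) :|: K by rewrite -{1}(setID D K) setUC (setIidPr KD).
have cD : #|D| = #|D :\: K| + 4.
  by rewrite cardsD (setIidPr KD) -KK.1 subnK // subset_leq_card.
rewrite {1 2}DE arcsUU // (clique_edges KK.2) KK.1.
have : edges (D :\: K) K <= 2 * #|D :\: K|.
  rewrite arcsE mulnC -sum_nat_const; apply: leq_sum => y; rewrite !inE => /andP[yK _].
  exact: K4_nbr_le2.
have := IH (D :\: K); rewrite cD in ltD *; move=> /(_ ltac:(lia)).
move: (edges _ _) (edges _ _) #|_| => a b m; nia.
Qed.

(** A vertex of degree d > 0 has a forest as link, hence at most d - 1 triangles. Summed and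
    combined with [edge_bound], this gives at most n^2 ordered triangles, fewer than [6 * h n] for n
    > 3. The cruder [leD] settles n = 3. *)
Lemma K4_free_tri D : (forall K, K \subset D -> ~ K4 K) -> 2 < #|D| ->
  (forall x, x \in D -> nbr D x != set0) ->
  tri D D D <= 6 * h #|D| /\ (3 < #|D| -> tri D D D < 6 * h #|D|).
Proof.
move=> noK D3 N0.
have L c : c \in D -> edges (nbr D c) (nbr D c) <= 2 * (#|nbr D c| - 1).
  by move=> cD; have := K4_free_forest noK cD (N0 c cD); lia.
have nbr_lt c : c \in D -> #|nbr D c| <= #|D|.-1.
  move=> cD; rewrite (cardsD1 c D) cD; apply/subset_leq_card/subsetP => y.
  by rewrite !inE => /andP[-> cy]; rewrite eq_sym (adj_neq cy).
have leD : tri D D D <= 2 * #|D| * (#|D| - 2).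
  rewrite triE mulnAC mulnC -sum_nat_const; apply: leq_sum => c cD.
  by have := L c cD; have := nbr_lt c cD; lia.
have leE : tri D D D + 2 * #|D| <= 2 * edges D D.
  rewrite triE arcsE big_distrr mulnC -sum_nat_const -big_split /=; apply: leq_sum => c cD.
  by have := L c cD; have := N0 c cD; rewrite -card_gt0; lia.
have := edge_bound D; have := @sqr_lt_6h #|D|.
move: (edges _ _) (tri _ _ _) leE leD D3 => E T.
case: (ltngtP 3 #|D|) => [D4||<-]; [by lia|by lia|].
have [_ _ _ /= ->] := h_4m 0; lia.
Qed.

(** * Triangles meeting a fixed K4 *)

Section Outside.
Variables K D : {set G}.
Hypothesis KK : K4 K.
Hypothesis dKD : [disjoint D & K].

Let ck : clique K := KK.2.

Lemma nbrK_sub y : nbr K y \subset K.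
Proof. by apply/subsetP => x; rewrite inE => /andP[]. Qed.

Definition seeing i := [set y in D | #|nbr K y| == i].

(** In the link of a vertex [x] of [K], a hanging vertex has no neighbour in the triangle [K :\ x],
    a braced one exactly one. *)
Definition hanging x := [set y in D | nbr K y == [set x]].

Definition braced x := [set y in seeing 2 | adj x y].

Definition mate y z := adj y z && (nbr K y == nbr K z).

Lemma outsideN y : y \in D -> y \notin K.
Proof. by move=> yD; rewrite (disjointFr dKD yD). Qed.

Lemma outside_neq x y : x \in K -> y \in D -> x != y.
Proof. by move=> xK yD; apply: contraTneq xK => ->; apply: outsideN. Qed.

Lemma seeing2P y x : y \in seeing 2 -> x \in nbr K y ->
  exists2 x', x' != x & nbr K y = [set x; x'] /\ x' \in K.
Proof.
rewrite inE => /andP[yD /cards2P[p [q [pq E]]]].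
have inK t : t \in nbr K y -> t \in K by rewrite inE => /andP[].
rewrite E !inE in inK * => /orP[]/eqP->.
- by exists q; [rewrite eq_sym|split=> //; apply: inK; rewrite !inE eqxx orbT].
- by exists p => //; split; [rewrite setUC|apply: inK; rewrite !inE eqxx].
Qed.

(** If the second seen vertices [y'] and [z'] differed, [y], [y'], [z'], [z] would be a 4-cycle
    around [x]. *)
Lemma shared_nbr y z x : y \in seeing 2 -> z \in seeing 2 -> adj y z ->
  x \in nbr K y -> x \in nbr K z -> nbr K y = nbr K z.
Proof.
move=> y2 z2 yz xy xz.
have [y' y'x [Ey y'K]] := seeing2P y2 xy; have [z' z'x [Ez z'K]] := seeing2P z2 xz.
have [yD zD] : y \in D /\ z \in D by move: y2 z2; rewrite !inE => /andP[-> _] /andP[->].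
have [yy' zz'] : adj y y' /\ adj z z'.
  have : y' \in nbr K y by rewrite Ey !inE eqxx orbT.
  have : z' \in nbr K z by rewrite Ez !inE eqxx orbT.
  by rewrite !inE => /andP[_ ->] /andP[_ ->].
move: xy xz; rewrite !inE => /andP[xK yx] /andP[_ zx].
rewrite Ey Ez; have [->//|ne] := eqVneq y' z'.
case: (@no_wheel4 x y y' z' z) => //.
- by rewrite e_sym.
- by apply: ck; rewrite 1?eq_sym.
- by apply: ck; rewrite 1?eq_sym.
- by rewrite e_sym.
- exact: ck.
- by rewrite e_sym.
- by rewrite e_sym.
- by rewrite eq_sym outside_neq.
- by rewrite outside_neq.
Qed.

(** If [y] sees [x] and [x'], two distinct mates give the 4-cycle [x'], [z], [y], [z'] around
    [x]. *)
Lemma mate_uniq y z z' : y \in seeing 2 -> z \in D -> z' \in D ->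
  mate y z -> mate y z' -> z = z'.
Proof.
move=> y2 zD z'D /andP[yz /eqP Ez] /andP[yz' /eqP Ez'].
have [x xy] : exists x, x \in nbr K y.
  by apply/set0Pn; move: y2; rewrite !inE -card_gt0 => /andP[_ /eqP->].
have [x' x'x [E x'K]] := seeing2P y2 xy.
have xin t : nbr K y = nbr K t -> adj x t /\ adj x' t.
  move=> Et; have : x \in nbr K t by rewrite -Et.
  have : x' \in nbr K t by rewrite -Et E !inE eqxx orbT.
  by rewrite !inE => /andP[_ tx'] /andP[_ tx]; rewrite e_sym tx e_sym tx'.
have [[xy1 xy2] [xz1 xz2] [xz1' xz2']] := And3 (xin y erefl) (xin z Ez) (xin z' Ez').
apply/eqP; apply: contraT => ne.
have xK : x \in K by move: xy; rewrite inE => /andP[].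
case: (@no_wheel4 x x' z y z') => //.
- by apply: ck; rewrite 1?eq_sym.
- by rewrite e_sym.
- by rewrite e_sym.
- by rewrite outside_neq //; move: y2; rewrite !inE => /andP[].
Qed.

Lemma outside_le2 y : y \in D -> #|nbr K y| <= 2.
Proof. by move=> yD; apply: K4_nbr_le2 (outsideN yD). Qed.

Lemma nbr_hanging_braced x : x \in K -> nbr D x = hanging x :|: braced x.
Proof.
move=> xK; apply/setP => y; rewrite !inE; case yD: (y \in D) => //=.
have := outside_le2 yD; case xy: (adj x y); rewrite ?andbT ?andbF ?orbF /=.
  have xN : x \in nbr K y by rewrite !inE xK e_sym.
  have := cards1P; have : 0 < #|nbr K y| by apply/card_gt0P; exists x.
  case E: #|nbr K y| => [|[|[|]]] // _ _ _; last by rewrite orbT.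
  by move/eqP/cards1P: E xN => [t ->]; rewrite inE => /eqP->; rewrite eqxx.
move=> _; apply/esym/negbTE/eqP => E; have : x \in nbr K y by rewrite E set11.
by rewrite inE e_sym xy andbF.
Qed.

Lemma braced2 x y : y \in braced x -> y \in seeing 2.
Proof. by rewrite !inE => /andP[]. Qed.

Lemma hangingD x y : y \in hanging x -> y \in D.
Proof. by rewrite inE => /andP[]. Qed.

Lemma seeingD i y : y \in seeing i -> y \in D.
Proof. by rewrite inE => /andP[]. Qed.

Lemma hanging_adj x y : y \in hanging x -> adj x y.
Proof.
rewrite !inE => /andP[_ /eqP E]; have : x \in nbr K y by rewrite E set11.
by rewrite inE e_sym => /andP[].
Qed.

Lemma braced_adj x y : y \in braced x -> adj x y.
Proof. by rewrite !inE => /andP[]. Qed.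

Lemma disjoint_hanging_braced x : [disjoint hanging x & braced x].
Proof.
rewrite -setI_eq0; apply/eqP/setP => y; rewrite !inE.
by case: eqP => [->|]; rewrite ?andbF // cards1 !andbF.
Qed.

(* Two distinct attachment vertices would close a long cycle in the link of [x]
   through one or two further vertices of [K]. *)
Lemma hanging_path x s p b b' : x \in K -> uniq (s :: p) -> path e s p ->
  {subset s :: p <= hanging x} -> b \in braced x -> b' \in braced x ->
  adj b s -> adj (last s p) b' -> b = b'.
Proof.
move=> xK us ep sub bB b'B bs lb'; apply/eqP/negPn/negP => ne.
have other t : t \in braced x -> exists y, [/\ y \in K, y != x & adj y t].
  move=> tB; have xt : x \in nbr K t by rewrite inE xK e_sym braced_adj.
  have [y yx [E yK]] := seeing2P (braced2 tB) xt; exists y; split=> //.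
  have : y \in nbr K t by rewrite E !inE eqxx orbT.
  by rewrite inE e_sym => /andP[].
have [y [yK yx yb]] := other _ bB; have [y' [y'K y'x y'b]] := other _ b'B.
have notin t : t \in braced x -> t \notin s :: p.
  move=> tB; apply/negP => /sub tS.
  by have := disjoint_hanging_braced x; rewrite disjoint_subset => /subsetP/(_ _ tS);
    rewrite inE tB.
have Knotin t : t \in K -> t \notin s :: p.
  by move=> tK; apply/negP => /sub/hangingD/(outside_neq tK); rewrite eqxx.
have Kneq t u : t \in K -> u \in braced x -> t != u.
  by move=> tK /braced2/seeingD/(outside_neq tK).
(* The list [q] leads inside [K] from [b'] to [y]: it is empty when [b] and [b'] both see [y], and a
   single vertex otherwise. *)
have lc q : path e b' (rcons q y) -> uniq (b' :: q) -> {subset q <= K} ->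
    y \notin q -> {in q, forall t, adj x t} -> False.
  move=> eq uq qK yq xq.
  suff : size (y :: b :: (s :: p) ++ b' :: q) <= 3 by rewrite /= size_cat /= addnS !ltnS
    ltn0.
  apply: (link_cycle (c := x)).
  - move: us notin Knotin {sub ep lb'}; move: (s :: p) => sp us notin Knotin.
    rewrite cons_uniq inE mem_cat (negbTE (Kneq y b yK bB)) (negbTE (Knotin y yK)) /=.
    rewrite inE (negbTE (Kneq y b' yK b'B)) (negbTE yq) /=.
    have bq : b \notin q by apply/negP => /qK /Kneq/(_ bB); rewrite eqxx.
    rewrite cat_uniq us uq andbT mem_cat inE (negbTE (notin b bB)) (negbTE ne) (negbTE bq)
      /=.
    rewrite negb_or (notin _ b'B) /=; apply/hasPn => t /qK; exact: Knotin.
  - by rewrite /= yb bs rcons_cat cat_path ep /= lb'.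
  - move=> t; rewrite inE => /orP[/eqP->|]; first by apply: ck; rewrite // eq_sym.
    rewrite inE => /orP[/eqP->|]; first exact: braced_adj.
    rewrite mem_cat => /orP[/sub/hanging_adj//|].
    by rewrite inE => /orP[/eqP->|/xq//]; apply: braced_adj.
have [E|nyy'] := eqVneq y y'.
  by apply: (lc [::]) => //=; rewrite e_sym E y'b.
apply: (lc [:: y']) => //=.
- by rewrite e_sym y'b ck // eq_sym.
- by rewrite inE andbT eq_sym; apply: Kneq.
- by move=> t; rewrite inE => /eqP->.
- by rewrite inE.
- by move=> t; rewrite inE => /eqP->; apply: ck; rewrite // eq_sym.
Qed.

Definition attached x s := [exists b in braced x, adj b s].

(* The link of [x], with the triangle [K :\ x] and the vertices braced by it
   contracted to the single vertex [x]. *)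
Definition contracted x u w :=
  if u == x then (w != x) && attached x w
  else if w == x then attached x u else adj u w.

Lemma contracted_sym x : symmetric (contracted x).
Proof.
by move=> u w; rewrite /contracted; do 2 case: eqP => //= _; rewrite e_sym.
Qed.

Lemma contracted_irr x : irreflexive (contracted x).
Proof. by move=> u; rewrite /contracted; case: eqP => //= _; rewrite e_irr. Qed.

Lemma hanging_neq x s : x \in K -> s \in hanging x -> s != x.
Proof. by move=> xK /hangingD sD; rewrite eq_sym (outside_neq). Qed.

(** A cycle avoiding [x] already lies in the link of [x]. In one through [x], both neighbours of [x]
    are attached to the same braced vertex by [hanging_path]; putting that vertex in place of [x]
    gives a cycle of the same length in the link. *)
Lemma contracted_cactus x : x \in K -> cactus (contracted x) (x |: hanging x).
Proof.
move=> xK c uc ec sub; rewrite leqNgt; apply/negP => c4.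
have toadj s p : {subset s :: p <= hanging x} -> path (contracted x) s p -> path e s p.
  elim: p s => //= s' p IH s sS /andP[ss' pS].
  have [sh s'h] : s \in hanging x /\ s' \in hanging x by split; apply: sS;
    rewrite !inE eqxx ?orbT.
  move: ss'; rewrite /contracted (negbTE (hanging_neq xK sh)) (negbTE (hanging_neq xK s'h))
    => -> /=.
  by apply: IH => // t ts; apply: sS; rewrite inE ts orbT.
have [xc|xNc] := boolP (x \in c); last first.
  have sS : {subset c <= hanging x}.
    move=> t tc; have := sub t tc; rewrite !inE => /orP[/eqP tx|//].
    by move: tc; rewrite tx (negbTE xNc).
  case: c uc ec sub c4 xNc sS => // s p uc /= ec _ c4 _ sS.
  suff : size (s :: p) <= 3 by rewrite leqNgt c4.
  apply: (link_cycle (c := x)) => //=; last by move=> t /sS/hanging_adj.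
  by apply: toadj ec => t; rewrite inE mem_rcons => /orP[/eqP->|/sS//]; apply: sS;
    rewrite inE eqxx.
have [i [|s p] E] := rot_to xc; first by move: c4; rewrite -(size_rot i) E.
have sS : {subset s :: p <= hanging x}.
  move=> t tp; have : t \in x |: hanging x by apply: sub;
    rewrite -(mem_rot i) E inE tp orbT.
  rewrite !inE => /orP[/eqP tx|//]; move: uc; rewrite -(rot_uniq i) E => /andP[].
  by rewrite -tx tp.
move: ec; rewrite -(rot_cycle i) E /= rcons_path => /and3P[xs ep lx].
have us : uniq (s :: p) by move: uc; rewrite -(rot_uniq i) E => /andP[].
have attach t : t \in s :: p -> contracted x t x -> attached x t.
  by move=> /sS/(hanging_neq xK)/negbTE tx; rewrite /contracted tx eqxx.
rewrite contracted_sym in xs.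
have /exists_inP[b bB bs] := attach s (mem_head _ _) xs.
have /exists_inP[b' b'B lb'] := attach _ (mem_last _ _) lx.
have {}ep := toadj _ _ sS ep.
have bb' : b = b' by apply: (hanging_path xK us ep sS bB b'B bs); rewrite e_sym.
suff : size (b :: s :: p) <= 3 by move: c4; rewrite -(size_rot i) E /= => *; lia.
apply: (link_cycle (c := x)).
- rewrite cons_uniq us andbT; apply/negP => /sS bS.
  by have := disjoint_hanging_braced x; rewrite disjoint_subset => /subsetP/(_ _ bS);
    rewrite inE bB.
- by rewrite /= rcons_path bs ep e_sym bb'.
- by move=> t; rewrite inE => /orP[/eqP->|/sS/hanging_adj//]; apply: braced_adj.
Qed.

Lemma hanging_braced_uniq x s b b' : x \in K -> s \in hanging x ->
  b \in braced x -> b' \in braced x -> adj s b -> adj s b' -> b = b'.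
Proof.
move=> xK sS bB b'B sb sb'; apply: (@hanging_path x s [::]) => //=; last by rewrite e_sym.
by move=> t; rewrite inE => /eqP->.
Qed.

(** The arcs of the link of [x] in [D] with at least one hanging end. *)
Definition hanging_weight x :=
  edges (hanging x) (hanging x) + 2 * edges (hanging x) (braced x).

Lemma hanging_weight_even x : ~~ odd (hanging_weight x).
Proof. by rewrite oddD mul2n odd_double addbF arcs_even. Qed.

(** This is [cactus_arcs] for the contracted graph on one vertex more than [hanging x]. Contraction
    loses no counted edge, because a hanging vertex has at most one neighbour braced by [x]. *)
Lemma hanging_weight_le x : x \in K -> hanging_weight x <= 3 * #|hanging x|.
Proof.
move=> xK.
have xS : x \notin hanging x by apply/negP => /(hanging_neq xK); rewrite eqxx.
have := @cactus_arcs _ _ (@contracted_sym x) (@contracted_irr x) (x |: hanging x) 3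
  (contracted_cactus xK).
have -> : (x |: hanging x != set0) by apply/set0Pn; exists x; rewrite setU11.
move=> /(_ isT (or_introl erefl)).
rewrite arcsUU ?disjoints1 //; last exact: contracted_sym.
rewrite (arcs_set1 (@contracted_irr x)) arcs1l cardsU1 xS.
have -> : arcs (contracted x) (hanging x) (hanging x) = edges (hanging x) (hanging x).
  apply: eq_bigr => y yS; apply: eq_bigr => z zS.
  by rewrite /contracted (negbTE (hanging_neq xK yS)) (negbTE (hanging_neq xK zS)).
suff : edges (hanging x) (braced x) <= #|nbhd (contracted x) (hanging x) x|.
  by rewrite /hanging_weight; lia.
rewrite arcsE -sum_card; apply: leq_sum => s sS.
rewrite /contracted eqxx (hanging_neq xK sS) /=.
have [at_s|/exists_inPn noB] := boolP (attached x s); last first.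
  rewrite leqn0 cards_eq0; apply/eqP/setP => b; rewrite inE [in RHS]inE.
  by apply/negP => /andP[bB sb]; have := noB b bB; rewrite e_sym sb.
rewrite leqNgt; apply/negP => /card_gt1P[b [b' [bs b's]]].
move: bs b's; rewrite inE => /andP[bB sb]; rewrite inE => /andP[b'B sb'].
by rewrite (hanging_braced_uniq xK sS bB b'B sb sb') eqxx.
Qed.

Definition mates := arcs mate (seeing 2) (seeing 2).

Definition weight := \sum_(x in K) hanging_weight x.

Lemma mate_sym : symmetric mate.
Proof. by move=> y z; rewrite /mate e_sym eq_sym. Qed.

Lemma mate_irr : irreflexive mate.
Proof. by move=> y; rewrite /mate e_irr. Qed.

Lemma mates_even : ~~ odd mates.
Proof. exact: arcs_even mate_sym mate_irr _. Qed.

Lemma mate_nbr_le1 y : y \in seeing 2 -> #|nbhd mate (seeing 2) y| <= 1.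
Proof.
move=> y2; rewrite leqNgt; apply/negP => /card_gt1P[z [z' [yz yz']]].
move: yz yz'; rewrite inE => /andP[/seeingD zD yz]; rewrite inE => /andP[/seeingD z'D yz'].
by rewrite (mate_uniq y2 zD z'D yz yz') eqxx.
Qed.

Lemma mates_le : mates <= #|seeing 2|.
Proof. by rewrite /mates arcsE -sum1_card; apply: leq_sum => y /mate_nbr_le1. Qed.

Lemma matesP y : mates = #|seeing 2| -> y \in seeing 2 ->
  exists2 z, z \in seeing 2 & mate y z.
Proof.
move=> E y2; have [N0|[z]] := set_0Vmem (nbhd mate (seeing 2) y); last first.
  by rewrite inE => /andP[z2 yz]; exists z.
suff : mates < #|seeing 2| by rewrite E ltnn.
rewrite /mates arcsE -sum1_card (bigD1 y) //= [X in _ < X](bigD1 y) //= N0 cards0.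
by rewrite add0n add1n ltnS; apply: leq_sum => t /andP[/mate_nbr_le1].
Qed.

Lemma weight_even : ~~ odd weight.
Proof.
apply: (big_ind (fun n => ~~ odd n)) => // [p q|x _]; last exact: hanging_weight_even.
by rewrite oddD => /negbTE-> /negbTE->.
Qed.

Lemma hanging_le_seeing1 : \sum_(x in K) #|hanging x| <= #|seeing 1|.
Proof.
rewrite -sum1_card.
under eq_bigr => x _ do rewrite -sum_card.
rewrite exchange_big /= [X in _ <= X]big_mkcond [X in X <= _]big_mkcond /=;
  apply: leq_sum => y _.
rewrite inE; case: (y \in D) => //=.
rewrite sum_card; case: eqP => [/eqP/cards1P[x E]|ne].
  rewrite -(cards1 x); apply/subset_leq_card/subsetP => t.
  by rewrite !inE E => /andP[_ /eqP/set1_inj->].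
rewrite leqn0 cards_eq0; apply/eqP/setP => x; rewrite !inE; apply/negP => /andP[_ /eqP E].
by apply: ne; rewrite E cards1.
Qed.

Lemma weight_le : weight <= 3 * #|seeing 1|.
Proof.
apply: leq_trans (_ : _ <= 3 * \sum_(x in K) #|hanging x|) _.
  by rewrite big_distrr; apply: leq_sum => x xK; apply: hanging_weight_le.
by rewrite leq_mul2l hanging_le_seeing1.
Qed.

(** By [shared_nbr] two adjacent vertices of [seeing 2] see equal or disjoint pairs, so the arc
    between them is counted for two vertices [x] if they are mates and for none otherwise. *)
Lemma braced_edges : \sum_(x in K) edges (braced x) (braced x) = 2 * mates.
Proof.
transitivity (\sum_(x in K) \sum_(y in seeing 2) \sum_(z in seeing 2)
    (adj y z && (adj x y && adj x z))).
  apply: eq_bigr => x _.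
  have sumB F : \sum_(y in braced x) F y = \sum_(y in seeing 2) if adj x y then F y else 0.
    by rewrite -big_mkcondr; apply: eq_bigl => y; rewrite inE.
  rewrite /arcs sumB; apply: eq_bigr => y _.
  case: (adj x y) => /=; last by rewrite big1 // => z _; rewrite andbF.
  by rewrite sumB; apply: eq_bigr => z _; case: (adj x z); rewrite ?andbT ?andbF.
rewrite exchange_big /mates big_distrr; apply: eq_bigr => y y2 /=.
rewrite exchange_big big_distrr; apply: eq_bigr => z z2 /=.
rewrite /mate; case yz: (adj y z) => /=; last by rewrite big1.
rewrite sum_card.
have -> : [set x in K | adj x y && adj x z] = nbr K y :&: nbr K z.
  apply/setP => x; rewrite !inE [adj x y]e_sym [adj x z]e_sym.
  by case: (x \in K).
have [E|ne] := eqVneq (nbr K y) (nbr K z).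
  by rewrite E setIid; move: z2; rewrite inE => /andP[_ /eqP].
rewrite muln0; apply/eqP; rewrite cards_eq0; apply/eqP/setP => x; rewrite inE in_set0.
apply/negP => /andP[xy xz]; case/eqP: ne.
exact: (shared_nbr y2 z2 yz xy xz).
Qed.

(** Sorts the triples by how many vertices lie in [K]. Three give 24 and two give [6 * #|seeing 2|];
    those with one are arcs in the links of vertices of [K], split into hanging and braced parts. *)
Lemma tri_outside : tri (D :|: K) (D :|: K) (D :|: K) =
  tri D D D + 24 + 6 * #|seeing 2| + 6 * mates + 3 * weight.
Proof.
rewrite triUUU // (clique_tri ck) KK.1 (triC23 D D) triC12 !triE.
have -> : \sum_(y in D) edges (nbr K y) (nbr K y) = 2 * #|seeing 2|.
  rewrite -sum_card big_distrr; apply: eq_bigr => y yD; rewrite clique_edges.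
    by have := outside_le2 yD; case: #|_| => [|[|[|]]].
  by move=> s t; rewrite !inE => /andP[sK _] /andP[tK _]; apply: ck.
have -> : \sum_(x in K) edges (nbr D x) (nbr D x) = weight + 2 * mates.
  rewrite -braced_edges -big_split; apply: eq_bigr => x xK.
  rewrite (nbr_hanging_braced xK) arcsUU ?disjoint_hanging_braced //.
  by rewrite /hanging_weight addnAC.
lia.
Qed.

(** * Structure around the K4 in the tight case *)

Lemma seeing2_nbr y : y \in seeing 2 -> #|nbr K y| = 2.
Proof. by rewrite inE => /andP[_ /eqP]. Qed.

Lemma adj_nbr_cases y z : y \in seeing 2 -> z \in seeing 2 -> adj y z ->
  nbr K z = nbr K y \/ nbr K z = K :\: nbr K y.
Proof.
move=> y2 z2 yz; have [dj|[x]] := set_0Vmem (nbr K y :&: nbr K z); last first.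
  by rewrite inE => /andP[xy xz]; left; rewrite (shared_nbr y2 z2 yz xy xz).
right; apply/eqP; rewrite eqEcard subsetD nbrK_sub disjoint_sym -setI_eq0 dj eqxx /=.
by rewrite cardsD (setIidPr (nbrK_sub y)) KK.1 !seeing2_nbr.
Qed.

(** Vertices seeing exactly [P] are put with [K :\: P], to which they have no edge; they form a
    matching by [mate_uniq]. *)
Definition side P := [set y in D | nbr K y == P] :|: (K :\: P).

Lemma side_low P : P \subset K -> #|P| = 2 -> low (side P).
Proof.
move=> PK P2.
have out x : x \in D -> nbr K x == P -> x \in seeing 2.
  by move=> xD /eqP E; rewrite inE xD E P2.
have sees x y : x \in D -> nbr K x == P -> y \in K :\: P -> adj x y -> False.
  move=> xD /eqP E; rewrite inE => /andP[yP yK] xy.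
  by move: yP; rewrite -E inE yK xy.
move=> x y z; rewrite !in_setU => xA yA zA xy xz.
case/orP: xA; last first.
  move=> xK.
  case/orP: yA; first by rewrite inE => /andP[yD Ey]; case: (sees y x yD Ey xK);
    rewrite e_sym.
  case/orP: zA; first by rewrite inE => /andP[zD Ez]; case: (sees z x zD Ez xK);
    rewrite e_sym.
  move=> zK yK; apply/eqP; apply: contraT => yz.
  suff : 2 < #|K :\: P| by rewrite cardsD (setIidPr PK) KK.1 P2.
  by apply/card_gt2P; exists x, y, z; split; split=> //; rewrite 1?eq_sym adj_neq // e_sym.
rewrite inE => /andP[xD Ex].
case/orP: yA; last by move=> /sees/(_ xy); case.
case/orP: zA; last by move=> /sees/(_ xz); case.
rewrite !inE => /andP[zD Ez] /andP[yD Ey].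
apply: (mate_uniq (out x xD Ex)) => //.
  by rewrite /mate xy (eqP Ex) eq_sym.
by rewrite /mate xz (eqP Ex) eq_sym.
Qed.

Lemma sideU P : P \subset K -> {in D, forall y, nbr K y = P \/ nbr K y = K :\: P} ->
  D :|: K = side P :|: side (K :\: P).
Proof.
move=> PK cl; apply/setP => y; rewrite !inE.
case yD: (y \in D) => /=.
  by case: (cl y yD) => ->; rewrite eqxx ?orbT.
by case yP: (y \in P); rewrite ?(subsetP PK _ yP) //=; case: (y \in K).
Qed.

Lemma side_disjoint P : P \subset K -> #|P| = 2 -> [disjoint side P & side (K :\: P)].
Proof.
move=> PK P2; rewrite -setI_eq0; apply/eqP/setP => y; rewrite !inE.
have [yD|yND] /= := boolP (y \in D).
  rewrite (negbTE (outsideN yD)) !andbF !orbF; apply/negP => /andP[/eqP-> /eqP E].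
  have : P :&: P = set0 by rewrite [X in X :&: _]E setIDAC setDIl setDv setI0.
  by rewrite setIid => P0; move: P2; rewrite P0 cards0.
by case: (y \in P); rewrite ?andbF //=; case: (y \in K).
Qed.

(** Along an edge the seen pair is kept or complemented, and [y0] reaches every vertex of the join
    within two steps, through [b0] for those in [A]. *)
Lemma classes_of_joined A B y0 : D = seeing 2 -> D = A :|: B -> joined A B ->
  0 < #|B| -> y0 \in A -> {in D, forall y, nbr K y = nbr K y0 \/ nbr K y = K :\: nbr K y0}.
Proof.
move=> D2 DE [_ _ _ cAB _] /card_gt0P[b0 b0B] y0A.
have in2 y : y \in A :|: B -> y \in seeing 2 by rewrite -DE {1}D2.
have [A2 B2] : {subset A <= seeing 2} /\ {subset B <= seeing 2}.
  by split=> y yA; apply: in2; rewrite inE yA ?orbT.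
have clB b : b \in B -> nbr K b = nbr K y0 \/ nbr K b = K :\: nbr K y0.
  by move=> bB; apply: adj_nbr_cases; [apply: A2|apply: B2|apply: cAB].
move=> y; rewrite DE inE => /orP[yA|]; last exact: clB.
have [E0|E0] := clB _ b0B; have := adj_nbr_cases (B2 _ b0B) (A2 _ yA);
  rewrite e_sym cAB // => /(_ isT); rewrite E0 //.
rewrite setDDr setDv set0U (setIidPr (nbrK_sub _)); tauto.
Qed.

(* Let [v] hang from [x], with its neighbour [u] braced by [x] and [u'] the mate of
   [u]. A common neighbour [b] of [v], [u], [u'] outside [K] gives the 4-cycle
   [x], [v], [b], [u'] around [u]; if there is none then two neighbours of [b]
   see the same pair as [b]. *)
Lemma hanging_impossible A B : D = A :|: B -> joined A B ->
  #|A| = 2 * ((#|D| + 1) %/ 4) -> odd #|D| -> 2 < #|D| ->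
  #|seeing 1| = 1 -> #|seeing 2| + 1 = #|D| -> mates = #|seeing 2| -> weight = 2 -> False.
Proof.
move=> DE jAB cA Dodd D3 /eqP/cards1P[v s1] s2 me we.
have v1 : v \in seeing 1 by rewrite s1 set11.
have vD := seeingD v1.
have [x Ev] : exists x, nbr K v = [set x] by apply/cards1P; move: v1;
  rewrite inE => /andP[].
have vx : x \in nbr K v by rewrite Ev set11.
have xK : x \in K by apply: (subsetP (nbrK_sub v)).
have vS : v \in hanging x by rewrite inE vD Ev eqxx.
have hang y : y \in K -> {subset hanging y <= [set v]}.
  by move=> yK t; rewrite -s1 !inE => /andP[-> /eqP->]; rewrite cards1.
have Sx : hanging x = [set v].
  by apply/eqP; rewrite eqEsubset sub1set vS andbT; apply/subsetP/hang.
have in2 y : y \in D -> y != v -> y \in seeing 2.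
  have cover : seeing 1 :|: seeing 2 = D.
    apply/eqP; rewrite eqEcard cardsU s1 cards1.
    have -> : [set v] :&: seeing 2 = set0.
      apply/setP => t; rewrite !inE; case: eqP => // ->.
      by rewrite Ev cards1 andbF.
    rewrite cards0 -s2 addnC subn0 leqnn andbT; apply/subsetP => t.
    by rewrite inE -s1 => /orP[]/seeingD.
  by rewrite -{1}cover inE s1 => /orP[/set1P->|//]; rewrite eqxx.
have [u uB vu] : exists2 u, u \in braced x & adj v u.
  (* Only [x] has a hanging vertex, namely [v], so the weight comes from edges between [v] and
     vertices braced by [x]. *)
  have : weight = 2 * #|nbr (braced x) v|.
    rewrite /weight (bigD1 x) //= /hanging_weight Sx arcs_set1 // arcs1l add0n.
    rewrite big1 ?addn0 // => y /andP[yK yx].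
    have -> : hanging y = set0.
      apply/setP => t; rewrite inE in_set0; apply/negP => /andP[tD /eqP Et].
      have : t \in [set v] by apply: (hang y yK); rewrite inE tD Et eqxx.
      rewrite inE => /eqP tv; move: Et; rewrite tv Ev => /set1_inj xy.
      by rewrite xy eqxx in yx.
    by rewrite /arcs !big_set0.
  rewrite we => N1; have : 0 < #|nbr (braced x) v| by move: N1; clear; lia.
  by case/card_gt0P => u; rewrite inE => /andP[uB vu]; exists u.
have u2 := braced2 uB; have uD := seeingD u2; have xu := braced_adj uB.
have xNu : x \in nbr K u by rewrite inE xK e_sym.
have [u' u'2 /andP[uu' /eqP Eu]] := matesP me u2.
have u'D := seeingD u'2.
have xNu' : x \in nbr K u' by rewrite -Eu.
have xu' : adj x u' by move: xNu'; rewrite inE e_sym => /andP[].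
have xv : adj x v := hanging_adj vS.
have Nxv b : b \in D -> adj v b -> adj x b -> b = u.
  move=> bD vb xb; have : b \in nbr D x by rewrite inE bD.
  rewrite (nbr_hanging_braced xK) Sx in_setU in_set1 => /orP[/eqP bv|bB].
    by move: vb; rewrite bv e_irr.
  by apply: (hanging_braced_uniq xK vS bB uB vb vu).
have vNu' : ~~ adj v u'.
  by apply/negP => vu'; move: uu'; rewrite (Nxv u' u'D vu' xu') e_irr.
have vu'_neq : v != u'.
  by apply: contraTneq u'2 => <-; rewrite inE Ev cards1 andbF.
have no_apex b : b \in D -> adj v b -> adj u b -> adj u' b -> False.
  move=> bD vb ub u'b; apply: (@no_wheel4 u x v b u') => //; rewrite 1?e_sym //.
  exact: (outside_neq xK bD).
have [X [Y [DX jXY vX szX]]] : exists X Y, [/\ D = X :|: Y, joined X Y, v \in X &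
    ~~ odd #|X| -> #|X| <= #|Y| + 1].
  have cD : #|D| = #|A| + #|B| by case: jAB => d _ _ _ _;
    rewrite DE cardsU disjoint_setI0 // cards0 subn0.
  move: (vD); rewrite DE inE => /orP[vA|vB]; [exists A, B|exists B, A]; split => //.
  - by move: cA Dodd cD; clear; lia.
  - by rewrite setUC.
  - exact: joinedC.
  - by move: cA Dodd cD; clear; lia.
have [dXY lX lY cXY [eX eY]] := jXY.
have XD t : t \in X -> t \in D by rewrite DX inE => ->.
have YD t : t \in Y -> t \in D by rewrite DX inE orbC => ->.
have inXY t : t \in D -> t \in X \/ t \in Y by rewrite DX inE => /orP.
have XYneq s t : s \in X -> t \in Y -> s != t.
  by move=> sX tY; apply: contraTneq tY => <-; rewrite (disjointFr dXY sX).
have u'X : u' \in X.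
  by case: (inXY u' u'D) => // u'Y; move: vNu'; rewrite cXY.
have uY : u \in Y.
  case: (inXY u uD) => // uX; case/eqP: vu'_neq.
  by apply: (lX u) => //; rewrite e_sym.
(* An even [Y] is perfectly matched, and the partner of [u] in it would be adjacent to [v], [u] and
   [u']. *)
have Yodd : odd #|Y|.
  apply: contraT => Yeven; have eY' : edges Y Y = #|Y| by move: eY Yeven; clear; lia.
  have [b bY ub] := low_perfect lY eY' uY.
  by case: (no_apex b (YD b bY)) => //; apply: cXY.
have cD : #|D| = #|X| + #|Y| by rewrite DX cardsU disjoint_setI0 // cards0 subn0.
have eX' : edges X X = #|X| by move: eX Dodd Yodd; rewrite cD; clear; lia.
have [w wX vw] := low_perfect lX eX' vX.
have [w' w'X u'w'] := low_perfect lX eX' u'X.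
have ww' : w != w'.
  apply: contraNneq vu'_neq => E; apply/eqP; apply: (lX w) => //; first by rewrite e_sym.
  by rewrite E e_sym.
have wu' : w != u' by apply: contraNneq vNu' => <-.
have w'v : w' != v by apply: contraNneq vNu' => <-; rewrite e_sym.
have X3 : 2 < #|X|.
  apply/card_gt2P; exists v, u', w; split; split=> //; first by rewrite eq_sym.
  by rewrite eq_sym adj_neq.
have [b bY bu] : exists2 b, b \in Y & b != u.
  have : 0 < #|Y :\ u| by have := cardsD1 u Y; rewrite uY; move: szX X3 Dodd Yodd;
    rewrite cD; clear; lia.
  by case/card_gt0P => b; rewrite !inE => /andP[bu bY]; exists b.
have wv : w != v by rewrite eq_sym adj_neq.
have bv : b != v by rewrite eq_sym XYneq.
have w2 := in2 w (XD w wX) wv; have w'2 := in2 w' (XD w' w'X) w'v.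
have b2 := in2 b (YD b bY) bv.
have notx t : t \in seeing 2 -> t \in D -> adj u t -> ~~ adj x t -> nbr K t = K :\: nbr K u.
  move=> t2 tD ut /negP xt; case: (adj_nbr_cases u2 t2 ut) => // Et; case: xt.
  by move: xNu; rewrite -Et inE e_sym => /andP[].
have uw : adj u w by rewrite e_sym cXY.
have uw' : adj u w' by rewrite e_sym cXY.
(* The partners [w] and [w'] of [v] and [u'], and the second vertex [b] of [Y], all see the
   complement of the pair of [u]; thus [b] has two mates. *)
have Ew : nbr K w = K :\: nbr K u.
  apply: notx (XD w wX) uw _ => //; apply/negP => xw.
  by have := XYneq w u wX uY; rewrite (Nxv w (XD w wX) vw xw) eqxx.
have Ew' : nbr K w' = K :\: nbr K u.
  apply: notx (XD w' w'X) uw' _ => //; apply/negP => xw'.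
  have xNw' : x \in nbr K w' by rewrite inE xK e_sym.
  have Ew' := shared_nbr u'2 w'2 u'w' xNu' xNw'.
  have := XYneq w' u w'X uY; rewrite (mate_uniq u'2 (XD _ w'X) uD) ?eqxx //.
    by rewrite /mate u'w' Ew' eqxx.
  by rewrite /mate e_sym uu' Eu eqxx.
have Eb : nbr K b = K :\: nbr K u.
  case: (adj_nbr_cases u'2 b2 (cXY _ _ u'X bY)); rewrite -Eu // => Eb.
  have xb : adj x b by move: xNu; rewrite -Eb inE e_sym => /andP[].
  by move: bu; rewrite (Nxv b (YD b bY) (cXY _ _ vX bY) xb) eqxx.
case/eqP: ww'; apply: (mate_uniq b2 (XD w wX) (XD w' w'X)).
  by rewrite /mate e_sym cXY //= Eb Ew.
by rewrite /mate e_sym cXY //= Eb Ew'.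
Qed.

End Outside.

(** Adjacent vertices see equal or complementary pairs, so the claim spreads over a connected [D].
    Extremality makes [D] connected from three vertices on; two vertices are mates by the count. *)
Lemma paired_class K D : K4 K -> [disjoint D & K] ->
  D = seeing K D 2 -> mates K D + odd #|D| = #|D| ->
  (2 < #|D| -> extremal_split D) ->
  exists P, [/\ P \subset K, #|P| = 2 & {in D, forall y, nbr K y = P \/ nbr K y = K :\: P}].
Proof.
move=> KK dKD D2 me ext; have [D0|[y0 y0D]] := set_0Vmem D.
  have [P PK P2] := sub_class set0 KK; exists P; split=> // y; by rewrite D0 inE.
have in2 y : y \in D -> y \in seeing K D 2 by rewrite {1}D2.
exists (nbr K y0); split; [exact: nbrK_sub|exact: (seeing2_nbr (in2 y0 y0D))|].
have [D3|D3] := ltnP 2 #|D|.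
  have [A [B [DE sA jAB]]] := ext D3.
  have cD : #|D| = #|A| + #|B|.
    by case: jAB => d _ _ _ _; rewrite DE cardsU disjoint_setI0 // cards0 subn0.
  have [A0 B0] : 0 < #|A| /\ 0 < #|B| by move: sA cD D3; clear; lia.
  move: (y0D); rewrite DE inE => /orP[yA|yB].
    by move=> y yAB; apply: (classes_of_joined KK dKD D2 DE jAB B0 yA); rewrite DE.
  move=> y yAB; apply: (classes_of_joined KK dKD D2 _ (joinedC jAB) A0 yB); rewrite ?DE //.
  by rewrite setUC.
move=> y yD; left; have [->//|yy0] := eqVneq y y0.
have cD : #|D| = 2.
  apply/eqP; rewrite eqn_leq D3; apply/card_gt1P; exists y, y0; split=> //.
have [z z2 /andP[yz /eqP Ez]] : exists2 z, z \in seeing K D 2 & mate K y z.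
  by apply: (matesP KK dKD _ (in2 y yD)); rewrite -D2 -[RHS]me cD addn0.
rewrite Ez; congr (nbr K _); apply/eqP; apply: contraT => zy0.
suff : 2 < #|D| by rewrite cD.
apply/card_gt2P; exists y, y0, z; split; split=> //; first exact: seeingD z2.
  by rewrite eq_sym.
by rewrite eq_sym adj_neq.
Qed.

(** * Induction for the bound and the equality case *)

Theorem tri_max D : tri D D D <= 6 * h #|D| /\
  (2 < #|D| -> tri D D D = 6 * h #|D| -> extremal_split D).
Proof.
(* Working with vertex subsets [D] lets the induction delete a K4 or an isolated vertex. *)
have [n] := ubnP #|D|; elim: n D => // n IH D ltD.
have [D2|D3] := leqP #|D| 2.
  by rewrite (low_tri (low_small D2)).
have [noK|/existsNP[K /not_implyP[KD /contrapT KK]]] := pselect (forall K, K \subset D -> ~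
  K4 K).
  have [x0 x0D] : exists x, x \in D by apply/card_gt0P; lia.
  have [/exists_inP[x xD /eqP N0]|/exists_inPn N0] := boolP [exists x in D, nbr D x ==
    set0].
    (* Deleting an isolated vertex keeps every triangle while [h] drops strictly, so equality cannot
       occur. *)
    have cx := cardsD1 x D; rewrite xD in cx.
    have [] := IH (D :\ x) ltac:(lia); rewrite -tri_isolated // => le _.
    have := h_lt D3; rewrite [#|D|.-1](_ : _ = #|D :\ x|); last by rewrite cx.
    by split; [lia|move=> _ E; exfalso; lia].
  (* Without K4, equality is left only for three vertices, where one vertex against the other two is
     the split. *)
  have [le lt] := K4_free_tri noK D3 N0; split=> // _ E.
  have cD : #|D| = 3 by apply/eqP; rewrite eqn_leq D3 andbT leqNgt; apply/negP => /lt;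
    rewrite E ltnn.
  have cx := cardsD1 x0 D; rewrite x0D cD in cx.
  apply: (@low_extremal [set x0] (D :\ x0)) => //; first by rewrite setD1K.
  - by rewrite disjoints1 !inE eqxx.
  - by apply: low_small; rewrite cards1.
  - by apply: low_small; lia.
have dj : [disjoint D :\: K & K] by rewrite -setI_eq0 setIDAC setDIl setDv setI0.
have DE : D = (D :\: K) :|: K by rewrite -{1}(setID D K) setUC (setIidPr KD).
have cD : #|D| = #|D :\: K| + 4.
  by rewrite cardsD (setIidPr KD) -KK.1 subnK // subset_leq_card.
move: (D :\: K) dj DE cD => D' dj DE cD.
have [le' ext'] := IH D' ltac:(lia).
have := tri_outside KK dj; rewrite -DE => T.
have s12 : #|seeing K D' 1| + #|seeing K D' 2| <= #|D'|.
  rewrite -cardsUI (_ : seeing K D' 1 :&: _ = set0) ?cards0 ?addn0.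
    by apply/subset_leq_card/subsetP => t; rewrite inE => /orP[]/seeingD.
  by apply/setP => t; rewrite !inE; case: eqP => [->|]; rewrite ?andbF.
have [le eq] := outside_arith T (mates_even K D') (mates_le KK dj) (weight_even K D')
  (weight_le KK dj) s12 le'.
rewrite cD; split=> // D'3 E; have [E' alt] := eq E.
have {}ext' : 2 < #|D'| -> extremal_split D' by move=> D'3'; apply: ext'.
case: alt => [[s1 s2 me]|[Do s1 s2 me we]]; last first.
  (* [D'] has odd order, and a single vertex spans no arc, which would make the weight 0 instead of
     2. *)
  have D'4 : 2 < #|D'|.
    rewrite ltnNge; apply/negP => D'2; have D'1 : #|D'| == 1 by move: Do D'2; clear; lia.
    have /cards1P[v Dv] := D'1; suff : weight K D' = 0 by rewrite we.
    apply: big1 => x xK; apply/eqP; rewrite -leqn0 -(arcs_set1 e_irr v) -Dv.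
    apply: leq_trans (_ : _ <= edges (nbr D' x) (nbr D' x)) _.
      rewrite (nbr_hanging_braced KK dj xK) arcsUU ?disjoint_hanging_braced //.
      by rewrite /hanging_weight; clear; lia.
    by apply: arcsS; apply/subsetP => t; rewrite inE => /andP[].
  have [A [B [DE' sA jAB]]] := ext' D'4.
  by case: (hanging_impossible KK dj DE' jAB sA Do D'4 s1 s2 me we).
have D2 : D' = seeing K D' 2.
  apply/eqP; rewrite eq_sym eqEcard s2 leqnn andbT; apply/subsetP => t; exact: seeingD.
have [P [PK P2 cl]] := paired_class KK dj D2 me ext'.
have KP2 : #|K :\: P| = 2 by rewrite cardsD (setIidPr PK) KK.1 P2.
apply: (low_extremal _ (side_disjoint dj PK P2) (side_low KK dj PK P2)).
- by rewrite DE (sideU PK cl).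
- by apply: (side_low KK dj) => //; apply: subsetDl.
- by rewrite cD addnC.
- by rewrite cD.
Qed.

End Graph.

(** * The graph H(n) and the theorem *)

Lemma triangles_iso (G G' : sgraph) : isomorphic G G' -> #|triangles G| = #|triangles G'|.
Proof.
case=> f [bf fA]; apply/eqP; rewrite -(eqn_pmul2l (isT : 0 < 6)) -!tri_triangles; apply/eqP.
rewrite /tri [RHS](reindex f) /=; last exact: onW_bij.
apply: eq_big => [x|x _]; first by rewrite !inE.
rewrite [RHS](reindex f) /=; last exact: onW_bij.
apply: eq_big => [y|y _]; first by rewrite !inE.
rewrite [RHS](reindex f) /=; last exact: onW_bij.
by apply: eq_big => [z|z _]; rewrite ?inE // !fA.
Qed.

Lemma H2_joined a b : exists A B : {set H2 a b},
  [/\ A :|: B = setT, #|A| = a, #|B| = b & joined A B].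
Proof.
pose A : {set H2 a b} := [set u | if u is inl _ then true else false].
pose B : {set H2 a b} := [set u | if u is inl _ then false else true].
have cA : #|A| = a.
  rewrite -[RHS]card_ord -cardsT -(card_imset _ (@inl_inj 'I_a 'I_b)).
  apply: eq_card => -[i|i]; rewrite inE; first by rewrite imset_f ?inE.
  by apply/esym/negbTE/imsetP => -[j].
have cB : #|B| = b.
  rewrite -[RHS]card_ord -cardsT -(card_imset _ (@inr_inj 'I_a 'I_b)).
  apply: eq_card => -[i|i]; rewrite inE; last by rewrite imset_f ?inE.
  by apply/esym/negbTE/imsetP => -[j].
have adjl (i j : 'I_a) : adj (inl i : H2 a b) (inl j) = (i != j) && (i./2 == j./2).
  by rewrite /= /simple_closure /= (eq_sym j./2) orbb.
have adjr (i j : 'I_b) : adj (inr i : H2 a b) (inr j) = (i != j) && (i./2 == j./2).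
  by rewrite /= /simple_closure /= (eq_sym j./2) orbb.
have pair3 k (i j l : 'I_k) : i != j -> i./2 == j./2 -> i != l -> i./2 == l./2 -> j = l.
  rewrite -!val_eqE /= => ij /eqP ij2 il /eqP il2; apply: val_inj => /=.
  by move: ij ij2 il il2; clear; lia.
have unpaired k (i j : 'I_k) : (forall l : 'I_k, i != l -> i./2 != l./2) ->
    (forall l : 'I_k, j != l -> j./2 != l./2) -> i = j.
  (* An unmatched index is not odd, since [l.-1] would be its partner, and [l.+1] is out of range,
     so it is the last one. *)
  have last (l : 'I_k) : (forall t : 'I_k, l != t -> l./2 != t./2) -> l.+1 = k.
    move=> Nl; have lk := ltn_ord l.
    have [o|ev] := boolP (odd l).
      have lt : l.-1 < k by lia.
      have := Nl (Ordinal lt); rewrite -val_eqE /=; move: o; clear; lia.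
    apply/eqP; rewrite eqn_leq lk leqNgt; apply/negP => lt.
    by have := Nl (Ordinal lt); rewrite -val_eqE /=; move: ev; clear; lia.
  by move=> /last Ei /last Ej; apply: val_inj => /=; lia.
have lA : low A.
  move=> [i|i] [j|j] [l|l]; rewrite !inE // !adjl => _ _ _ /andP[ij ij2] /andP[il il2].
  by rewrite (pair3 _ i j l).
have lB : low B.
  move=> [i|i] [j|j] [l|l]; rewrite !inE // !adjr => _ _ _ /andP[ij ij2] /andP[il il2].
  by rewrite (pair3 _ i j l).
exists A, B; split=> //; first by apply/setP => -[i|i]; rewrite !inE.
split=> //.
- by rewrite -setI_eq0; apply/eqP/setP => -[i|i]; rewrite !inE.
- by move=> [i|i] [j|j]; rewrite !inE.
- have nA (i : 'I_a) : nbhd (@adj (H2 a b)) A (inl i) = set0 -> forall l : 'I_a, i != l ->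
    i./2 != l./2.
    by move=> /setP N l il; have := N (inl l); rewrite !inE adjl il /= => ->.
  have nB (i : 'I_b) : nbhd (@adj (H2 a b)) B (inr i) = set0 -> forall l : 'I_b, i != l ->
    i./2 != l./2.
    by move=> /setP N l il; have := N (inr l); rewrite !inE adjr il /= => ->.
  split; apply: low_edges_max => //.
    by move=> [i|i] [j|j]; rewrite !inE // => _ _ /nA Ni /nA Nj; rewrite (unpaired _ i j).
  by move=> [i|i] [j|j]; rewrite !inE // => _ _ /nB Ni /nB Nj; rewrite (unpaired _ i j).
Qed.

(** K3 and K4 are joins as well, so H(n) needs no separate treatment for n <= 4. *)
Lemma complete_joined n : 2 < n <= 4 -> exists A B : {set complete n},
  [/\ A :|: B = setT, #|A| = 2, #|B| = n - 2 & joined A B].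
Proof.
move=> /andP[n3 n4]; have n2 : n - 2 = 1 \/ n - 2 = 2 by lia.
have cK (A : {set complete n}) : clique A by move=> x y _ _ xy; apply/andP; split.
pose x0 : complete n := Ordinal (ltnW (ltnW n3)).
pose x1 : complete n := Ordinal (ltnW n3).
pose A : {set complete n} := [set x0; x1].
have cA : #|A| = 2 by rewrite cards2.
have cB : #|~: A| = n - 2 by rewrite cardsCs setCK cA card_ord.
exists A, (~: A); split=> //; first by rewrite setUCr.
split.
- by rewrite -setI_eq0 setICr.
- by apply: low_small; rewrite cA.
- by apply: low_small; rewrite cB; lia.
- by move=> x y xA yA; apply/andP; split=> //; apply: contraTneq yA => <-; rewrite inE xA.
- rewrite !(clique_edges (cK _)) cA cB; split=> //.
  by case: n2 => ->.
Qed.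

Lemma H_joined n : 2 < n -> exists A B : {set H n},
  [/\ A :|: B = setT, #|A| = 2 * ((n + 1) %/ 4), #|A| + #|B| = n & joined A B].
Proof.
move=> n3; rewrite /H; have [n4|n5] := leqP n 4.
  have [A [B [AB cA cB j]]] := complete_joined (introT andP (conj n3 n4)).
  by exists A, B; split=> //; lia.
have E a b : a + b = n -> a = 2 * ((n + 1) %/ 4) -> exists A B : {set H2 a b},
    [/\ A :|: B = setT, #|A| = 2 * ((n + 1) %/ 4), #|A| + #|B| = n & joined A B].
  by move=> abn aE; have [A [B [AB cA cB j]]] := H2_joined a b; exists A, B; rewrite cA cB.
case r: (n %% 4) => [|[|[|r']]]; [apply: E; lia..|].
have [A [B [AB cA cB j]]] := H2_joined (2 * (n %/ 4) + 1) (2 * (n %/ 4) + 2).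
have {}r : n %% 4 = 3 by have := ltn_mod n 4; lia.
(* For n = 4m + 3 the even part is the second one, of size 2m + 2. *)
exists B, A; rewrite setUC cA cB; split=> //; [lia|lia|exact: joinedC].
Qed.

Theorem theorem1 (n : nat) (hn : 3 <= n) :
  ex_K3 n wheels_ge4 = h n /\
  (forall G : sgraph, #|G| = n -> is_free wheels_ge4 G ->
     #|triangles G| = h n -> isomorphic G (H n)) /\
  (#|H n| = n /\ is_free wheels_ge4 (H n) /\ #|triangles (H n)| = h n).
Proof.
have [A [B [AB cA cAB jAB]]] := H_joined hn.
have [dAB lA lB _ _] := jAB.
have cH : #|H n| = n by rewrite -cardsT -AB cardsU disjoint_setI0 // cards0 subn0.
have fH : is_free wheels_ge4 (H n) by exact: low_free AB lA lB.
have tH : #|triangles (H n)| = h n.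
  apply/eqP; rewrite -(eqn_pmul2l (isT : 0 < 6)) -tri_triangles -AB (joined_tri jAB).
  by rewrite h_extremal cAB.
have x0 : H n by apply: (enum_val (A := H n)); rewrite cH; exact: Ordinal hn.
split; last split=> //.
- apply/eqP; rewrite eqn_leq; apply/andP; split.
    apply/bigmax_leqP => E /asboolP fE.
    have [le _] := tri_max (free_wheel_free fE) setT.
    by move: le; rewrite tri_triangles leq_pmul2l // cardsT card_ord.
  (* For the lower bound H(n) is carried over to the vertex set ['I_n] along an enumeration. *)
  pose g (i : 'I_n) : H n := enum_val (cast_ord (esym cH) i).
  have bg : bijective g.
    apply: inj_card_bij; last by rewrite cH card_ord.
    by move=> i j /enum_val_inj/cast_ord_inj.
  pose E := [set p : 'I_n * 'I_n | adj (g p.1) (g p.2)].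
  have iE : isomorphic (of_rel (fun x y => (x, y) \in E)) (H n).
    exists g; split=> // x y; rewrite /= /simple_closure /= !inE /= (adj_sym (g y)) orbb.
    by case: eqP => [->|]; rewrite ?adj_irr.
  rewrite -tH -(triangles_iso iE); apply: (@leq_bigmax_cond _ _ _ E).
  by apply/asboolP; apply: is_free_iso fH; apply: isomorphic_sym.
- move=> G cG fG tG.
  have [_] := tri_max (free_wheel_free fG) setT.
  rewrite tri_triangles tG cardsT cG => /(_ hn erefl)[A' [B' [/esym AB' cA' j']]].
  rewrite cardsT cG -cA in cA'.
  have cB' : #|B'| = #|B|.
    have [d' _ _ _ _] := j'.
    have : #|G| = #|A'| + #|B'| by rewrite -cardsT -AB' cardsU disjoint_setI0 // cards0
      subn0.
    by rewrite cG cA'; move: cAB; clear; lia.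
  have y0 : G by apply: (enum_val (A := G)); rewrite cG; exact: Ordinal hn.
  (* Both graphs are joins with the same part sizes, hence isomorphic to the same [H2]. *)
  apply: isomorphic_trans (joined_iso y0 AB' j') _; rewrite cA' cB'.
  exact/isomorphic_sym/(joined_iso x0 AB jAB).
Qed.
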